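(* Let $M$ be a compact pointed metric space. Then the following properties are equivalent. (i) $s_0(M)$ is weak$^*$-dense in $\mathrm{Lip}_0(M)$. (ii) The set $\{f\in \mathrm{Lip}_0(M): \lambda(f(M))=0\}$ is weak$^*$-dense in $\mathrm{Lip}_0(M)$. (iii) $s_0(M)$ separates points of $M$ uniformly. (iv) The set $\{f\in \mathrm{Lip}_0(M): \lambda(f(M))=0\}$ separates points of $M$ uniformly. (v) $M$ is Lip-lin injective and totally disconnected.
   Context: A pointed metric space is a metric space with a distinguished base point $0$. $\mathrm{Lip}_0(M,N)$ is the set of Lipschitz maps $f\colon M\to N$ with $f(0)=0$; $\mathrm{Lip}_0(M)=\mathrm{Lip}_0(M,\mathbb R)$ is a Banach space for the norm $\|f\|_L$ = best Lipschitz constant of $f$. For $x\in M$, $\delta(x)\in \mathrm{Lip}_0(M)^*$ is the evaluation $\langle f,\delta(x)\rangle=f(x)$. The Lipschitz-free space $\mathcal F(M)$ is the norm-closed linear span of $\{\delta(x):x\in M\}$ in $\mathrm{Lip}_0(M)^*$; one has $\mathcal F(M)^*=\mathrm{Lip}_0(M)$ isometrically, and the weak$^*$ topology on $\mathrm{Lip}_0(M)$ refers to this duality. For $f\in \mathrm{Lip}_0(M,N)$, $\widehat f\colon \mathcal F(M)\to\mathcal F(N)$ is the unique bounded linear operator with $\widehat f(\delta(x))=\delta(f(x))$ for all $x\in M$. A complete pointed metric space $M$ is Lip-lin injective if for every complete pointed metric space $N$ and every injective $f\in \mathrm{Lip}_0(M,N)$, the operator $\widehat f$ is injective. $s_0(M)=\{f\in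 \mathrm{Lip}_0(M): f \text{ is locally constant}\}$. A set $S\subset \mathrm{Lip}_0(M)$ separates the points of $M$ uniformly if there is $C\ge 1$ such that for all $x\ne y$ in $M$ there is $f\in S$ with $\|f\|_L\le C$ and $|f(x)-f(y)|=d(x,y)$. $\lambda$ is Lebesgue measure on $\mathbb R$. $M$ is totally disconnected if its connected components are the one-point sets. *)

(* Defs.v *)
From HB Require Import structures.
From mathcomp Require Import all_boot all_order all_algebra.
From mathcomp Require Import all_classical all_reals all_analysis.

Set Implicit Arguments.
Unset Strict Implicit.
Unset Printing Implicit Defensive.

Import Order.TTheory GRing.Theory Num.Theory.
Import numFieldNormedType.Exports.

Local Open Scope classical_set_scope.
Local Open Scope ring_scope.

(* The least C >= 0 such that |h i| <= C * w i for all i (see best_constP). It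
   is used for both the Lipschitz constant and the norm of a functional. *)
Section best_const.
Context {R : realType} {I : Type}.
Implicit Types (h w : I -> R).

Definition const_bound h w : set R :=
  [set C | 0 <= C /\ forall i, `|h i| <= C * w i].

Definition best_const h w : R := inf (const_bound h w).

Lemma best_const_ge0 h w : 0 <= best_const h w.
Proof.
rewrite /best_const; have [->|/set0P C0] := eqVneq (const_bound h w) set0.
  by rewrite inf0.
by apply: lb_le_inf => // C [].
Qed.

Lemma best_const_le h w C : const_bound h w C -> best_const h w <= C.
Proof. by move=> hC; apply: ge_inf => //; exists 0 => ? []. Qed.

Lemma best_constP h w : (forall i, 0 <= w i) -> const_bound h w !=set0 ->
  const_bound h w (best_const h w).
Proof.
move=> w0 C0; split; first exact: best_const_ge0.
move=> i; have [wi0|wi0] := eqVneq (w i) 0.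
  by have [C [_ /(_ i)]] := C0; rewrite wi0 !mulr0.
rewrite -ler_pdivrMr ?lt_neqAle 1?eq_sym ?wi0 ?w0//.
apply: lb_le_inf => // C [_ /(_ i)].
by rewrite ler_pdivrMr// lt_neqAle eq_sym wi0 w0.
Qed.

Lemma best_constD h1 h2 w : (forall i, 0 <= w i) ->
  const_bound h1 w !=set0 -> const_bound h2 w !=set0 ->
  best_const (fun i => h1 i + h2 i) w <= best_const h1 w + best_const h2 w.
Proof.
move=> w0 /(best_constP w0)[p1 b1] /(best_constP w0)[p2 b2].
apply: best_const_le; split; first exact: addr_ge0.
by move=> i; rewrite (le_trans (ler_normD _ _))// mulrDl lerD.
Qed.

Let best_constZ_le (a : R) h w : (forall i, 0 <= w i) ->
  const_bound h w !=set0 ->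
  best_const (fun i => a * h i) w <= `|a| * best_const h w.
Proof.
move=> w0 /(best_constP w0)[p b]; apply: best_const_le.
by split=> [|i]; rewrite ?mulr_ge0// normrM -mulrA ler_wpM2l.
Qed.

Lemma best_constZ (a : R) h w : (forall i, 0 <= w i) ->
  const_bound h w !=set0 ->
  best_const (fun i => a * h i) w = `|a| * best_const h w.
Proof.
move=> w0 C0; apply/eqP; rewrite eq_le best_constZ_le//=.
have [->|a0] := eqVneq a 0; first by rewrite normr0 mul0r best_const_ge0.
rewrite -ler_pdivlMl ?normr_gt0// -normfV.
have {1}-> : h = (fun i => a^-1 * (a * h i)).
  by apply/funext => i; rewrite mulKf.
apply: best_constZ_le => //.
have [C [C_ge0 hC]] := C0; exists (`|a| * C); split; first by rewrite mulr_ge0.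
by move=> i; rewrite normrM -mulrA ler_wpM2l.
Qed.

Lemma best_const_eq0 h w : (forall i, 0 <= w i) -> const_bound h w !=set0 ->
  best_const h w = 0 -> forall i, h i = 0.
Proof.
move=> w0 /(best_constP w0)[_ b] e i; apply/eqP.
by have := b i; rewrite e mul0r normr_le0.
Qed.

End best_const.

Section dual.
Context {R : realType} (V : normedModType R).

Definition dual_pred : {pred V -> R^o} :=
  mem [set phi : V -> R^o | linear phi /\ continuous phi].

Record dual := Dual { dual_fun :> V -> R^o; _ : dual_fun \in dual_pred }.

HB.instance Definition _ := [isSub for dual_fun].
HB.instance Definition _ := [Choice of dual by <:].

Lemma dual_subspace : submod_closed dual_pred.
Proof.
split.
  rewrite inE; split; last by move=> x; exact: cvg_cst.
  by move=> a u v; rewrite -[0]/(cst 0) /cst scaler0 addr0.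
move=> a f g /[!inE] -[lf cf] [lg cg]; split.
  move=> b u v; rewrite !fctE lf lg !scalerDr addrACA; congr (_ + _ + _).
  by rewrite !scalerA mulrC.
by move=> x; apply: cvgD; [apply: cvgZr; exact: cf|exact: cg].
Qed.

HB.instance Definition _ :=
  GRing.isSubmodClosed.Build R (V -> R^o) dual_pred dual_subspace.
HB.instance Definition _ := [SubChoice_isSubLmodule of dual by <:].

Lemma dual_linear (phi : dual) : linear phi.
Proof. by case: phi => phi /= /[!inE] -[]. Qed.

Lemma dual_continuous (phi : dual) : continuous phi.
Proof. by case: phi => phi /= /[!inE] -[]. Qed.

Definition dual_norm (phi : dual) : R := best_const phi (fun v => `|v|).

Lemma dual_bound (phi : dual) : const_bound phi (fun v => `|v|) !=set0.
Proof.
pose f : {linear V -> R^o} :=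
  HB.pack (phi : V -> R^o) (GRing.isLinear.Build _ _ _ _ _ (dual_linear phi)).
have /linear_boundedP[M [_ Mf]] : bounded_near f (nbhs (0 : V)).
  by apply/linear_bounded_continuous; exact: dual_continuous.
exists (Num.max M 0 + 1); split.
  by rewrite addr_ge0// le_max lexx orbT.
by move=> v; apply: Mf; rewrite ltr_pwDr// le_max lexx.
Qed.

Lemma dual_normD phi psi : dual_norm (phi + psi) <= dual_norm phi + dual_norm psi.
Proof. by apply: best_constD => //; exact: dual_bound. Qed.

Lemma dual_normZ a phi : dual_norm (a *: phi) = `|a| * dual_norm phi.
Proof. exact: (best_constZ a (@normr_ge0 _ _) (dual_bound phi)). Qed.

Lemma dual_norm_eq0 phi : dual_norm phi = 0 -> phi = 0.
Proof.
move=> /best_const_eq0 phi0; apply/val_inj/funext => v.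
by apply: phi0 => //; exact: dual_bound.
Qed.

HB.instance Definition _ :=
  Lmodule_isNormed.Build R dual dual_normD dual_normZ dual_norm_eq0.

End dual.

Arguments dual_pred {R} V.

Definition lipschitz_map {R : realType} {M N : metricType R} (f : M -> N) :=
  exists L : R, forall x y, mdist (f x) (f y) <= L * mdist x y.

(* The pair of a metric space M and of a point o : M stands for the pointed
   metric space M with base point o. *)
Definition lip0_map {R : realType} {M N : metricType R} (o : M) (o' : N) :
  set (M -> N) := [set f | lipschitz_map f /\ f o = o'].

Section lip0.
Context {R : realType} {M : metricType R} (o : M).

Definition lip0_pred : {pred M -> R^o} := mem (lip0_map o (0 : R^o)).

Record lip0 := Lip0 { lip0_fun :> M -> R^o; _ : lip0_fun \in lip0_pred }.

HB.instance Definition _ := [isSub for lip0_fun].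
HB.instance Definition _ := [Choice of lip0 by <:].

Lemma lip0_subspace : submod_closed lip0_pred.
Proof.
split.
  rewrite inE; split=> //; exists 0 => x y.
  by rewrite -[0]/(cst 0) /mdist/= subrr normr0 mul0r.
move=> a f g /[!inE] -[[L Lf] f0] [[K Kg] g0]; split.
  exists (`|a| * L + K) => x y; rewrite !fctE {1}/mdist/=.
  rewrite opprD addrACA -scalerBr mulrDl.
  rewrite (le_trans (ler_normD _ _))// lerD//; last exact: Kg.
  by rewrite normrZ -mulrA ler_wpM2l//; exact: Lf.
by rewrite !fctE f0 g0 scaler0 addr0.
Qed.

HB.instance Definition _ :=
  GRing.isSubmodClosed.Build R (M -> R^o) lip0_pred lip0_subspace.
HB.instance Definition _ := [SubChoice_isSubLmodule of lip0 by <:].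

Definition lip_norm (f : lip0) : R :=
  best_const (fun p : M * M => f p.1 - f p.2) (fun p => mdist p.1 p.2).

Lemma lip0_base (f : lip0) : f o = 0.
Proof. by case: f => f /= /[!inE] -[]. Qed.

Lemma lip0_bound (f : lip0) :
  const_bound (fun p : M * M => f p.1 - f p.2) (fun p => mdist p.1 p.2) !=set0.
Proof.
case: f => f /= /[!inE] -[[L Lf] _]; exists (Num.max L 0); split.
  by rewrite le_max lexx orbT.
move=> [x y] /=; rewrite distrC (le_trans (Lf x y))//.
by rewrite ler_wpM2r ?mdist_ge0// le_max lexx.
Qed.

Lemma lip_normD f g : lip_norm (f + g) <= lip_norm f + lip_norm g.
Proof.
rewrite /lip_norm.
under [X in best_const X]eq_fun do rewrite /= !fctE opprD addrACA.
by apply: best_constD; [move=> i; exact: mdist_ge0|exact: lip0_bound..].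
Qed.

Lemma lip_normZ a f : lip_norm (a *: f) = `|a| * lip_norm f.
Proof.
rewrite /lip_norm.
under [X in best_const X]eq_fun do rewrite /= !fctE -scalerBr.
by apply: best_constZ; [move=> i; exact: mdist_ge0|exact: lip0_bound].
Qed.

Lemma lip_norm_eq0 f : lip_norm f = 0 -> f = 0.
Proof.
move=> /best_const_eq0 f0; apply/val_inj/funext => x.
have /(_ (x, o)) := f0 (fun=> mdist_ge0 _ _) (lip0_bound f).
by rewrite /= lip0_base subr0.
Qed.

HB.instance Definition _ :=
  Lmodule_isNormed.Build R lip0 lip_normD lip_normZ lip_norm_eq0.

Lemma lip0_le (f : lip0) x y : `|f x - f y| <= `|f| * mdist x y.
Proof.
have [_ /(_ (x, y))] := best_constP (fun=> mdist_ge0 _ _) (lip0_bound f).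
exact.
Qed.

Lemma delta_subproof (x : M) : (fun f : lip0 => f x) \in dual_pred lip0.
Proof.
have l : linear (fun f : lip0 => f x) by [].
rewrite inE; split => //.
pose g : {linear lip0 -> R^o} :=
  HB.pack (fun f : lip0 => f x) (GRing.isLinear.Build _ _ _ _ _ l).
apply: (@bounded_linear_continuous _ _ _ g); apply/linear_boundedP.
exists (mdist x o); split => [|C xC f]; first exact: num_real.
rewrite /= -[f x]subr0 -(lip0_base f) (le_trans (lip0_le _ _ _))// mulrC.
by rewrite ler_wpM2r// ltW.
Qed.

Definition delta (x : M) : dual lip0 := Dual (delta_subproof x).

Definition span_delta : set (dual lip0) :=
  [set phi | exists s : seq (R * M), phi = \sum_(p <- s) p.1 *: delta p.2].

Definition free_pred : {pred dual lip0} := mem (closure span_delta).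

Record free_space := FreeSpace
  { free_val :> dual lip0; _ : free_val \in free_pred }.

HB.instance Definition _ := [isSub for free_val].
HB.instance Definition _ := [Choice of free_space by <:].

Lemma free_val_closure (m : free_space) : closure span_delta (free_val m).
Proof. by case: m => m /= /[!inE]. Qed.

Lemma free_subspace : submod_closed free_pred.
Proof.
split.
  by rewrite inE; apply: subset_closure; exists [::]; rewrite big_nil.
move=> a m1 m2 /[!inE] h1 h2 U Um.
have am : a *: p.1 + p.2 @[p --> (m1, m2)] --> a *: m1 + m2.
  by apply: cvgD; [apply: cvgZr; exact: cvg_fst|exact: cvg_snd].
have [[A B] [/= mA mB] AB] := am _ Um.
have [p1 [[s1 sp1] Ap1]] := h1 _ mA.
have [p2 [[s2 sp2] Bp2]] := h2 _ mB.
exists (a *: p1 + p2); split; last exact: (AB (p1, p2)).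
exists ([seq (a * p.1, p.2) | p <- s1] ++ s2).
rewrite big_cat big_map/= sp1 sp2 scaler_sumr; congr (_ + _).
by apply: eq_bigr => i _; rewrite scalerA.
Qed.

HB.instance Definition _ :=
  GRing.isSubmodClosed.Build R (dual lip0) free_pred free_subspace.
HB.instance Definition _ := [SubChoice_isSubLmodule of free_space by <:].

Definition free_norm (m : free_space) : R := `|free_val m|.

Lemma free_normD m1 m2 : free_norm (m1 + m2) <= free_norm m1 + free_norm m2.
Proof. exact: ler_normD. Qed.

Lemma free_normZ a m : free_norm (a *: m) = `|a| * free_norm m.
Proof. exact: normrZ. Qed.

Lemma free_norm_eq0 m : free_norm m = 0 -> m = 0.
Proof. by move/normr0_eq0 => m0; exact: val_inj. Qed.

HB.instance Definition _ :=
  Lmodule_isNormed.Build R free_space free_normD free_normZ free_norm_eq0.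

Lemma free_delta_subproof x : delta x \in free_pred.
Proof.
rewrite inE; apply: subset_closure; exists [:: (1, x)].
by rewrite big_seq1 scale1r.
Qed.

Definition free_delta (x : M) : free_space := FreeSpace (free_delta_subproof x).

(* The topology of pointwise convergence on the elements of the free space. *)
Definition weak_star : topologicalType :=
  initial_topology
    (fun f : lip0 => (fun m => free_val m f) : {ptws free_space -> R^o}).

Definition weak_star_dense (S : set lip0) := dense (S : set weak_star).

Definition locally_constant_lip0 : set lip0 :=
  [set f : lip0 | forall x, \forall y \near x, f y = f x].

Definition null_image_lip0 : set lip0 :=
  [set f : lip0 | lebesgue_measure (range f : set R) = 0%E].

Definition separates_points_uniformly (S : set lip0) := exists2 C : R, 1 <= C &
  forall x y : M, x != y ->
  exists f : lip0, [/\ S f, `|f| <= C & `|f x - f y| = mdist x y].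

End lip0.

Arguments free_pred {R M} o.

(* The library's completeType requires a pointedType, which would impose a
   second distinguished point on T. *)
Definition complete_space (T : uniformType) :=
  forall F : set_system T, ProperFilter F -> cauchy F -> exists x : T, F --> x.

(* The operator induced by f between the free spaces is obtained by restricting
   the adjoint of composition with f; free_mapP and free_map_unique say that it
   is the unique bounded linear operator that maps delta x to delta (f x). *)
Section free_map.
Context {R : realType} {M N : metricType R} {o : M} {o' : N}.
Context (f : M -> N) (fL : lip0_map o o' f).

Lemma lip0_comp_subproof (g : lip0 o') : g \o f \in lip0_pred o.
Proof.
have [[L Lf] fo] := fL; rewrite inE; split; last by rewrite /= fo lip0_base.
exists (`|g| * L) => x y; rewrite /mdist/= distrC.
by rewrite (le_trans (lip0_le _ _ _))// -mulrA ler_wpM2l.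
Qed.

Definition lip0_comp (g : lip0 o') : lip0 o := Lip0 (lip0_comp_subproof g).

Lemma lip0_comp_linear : linear lip0_comp.
Proof. by move=> a g h; exact: val_inj. Qed.

Lemma lip0_comp_continuous : continuous lip0_comp.
Proof.
pose l : {linear lip0 o' -> lip0 o} :=
  HB.pack lip0_comp (GRing.isLinear.Build _ _ _ _ _ lip0_comp_linear).
apply: (@bounded_linear_continuous _ _ _ l); apply/linear_boundedP.
have [[L Lf] fo] := fL.
exists (Num.max L 0); split => [|C LC g]; first exact: num_real.
move: LC; rewrite gt_max => /andP[LC C0].
apply: best_const_le; split; first by rewrite mulr_ge0// ltW.
move=> [x y] /=; rewrite (le_trans (lip0_le _ _ _))//.
rewrite (mulrC C) -mulrA ler_wpM2l// (le_trans (Lf x y))//.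
by rewrite ler_wpM2r ?mdist_ge0// ltW.
Qed.

Lemma dual_comp_subproof (phi : dual (lip0 o)) :
  phi \o lip0_comp \in dual_pred (lip0 o').
Proof.
rewrite inE; split.
  by move=> a g h; rewrite /= lip0_comp_linear dual_linear.
move=> g; apply: continuous_comp; first exact: lip0_comp_continuous.
exact: dual_continuous.
Qed.

Definition dual_comp (phi : dual (lip0 o)) : dual (lip0 o') :=
  Dual (dual_comp_subproof phi).

Lemma dual_comp_linear : linear dual_comp.
Proof. by move=> a phi psi; exact: val_inj. Qed.

Lemma dual_le (V : normedModType R) (phi : dual V) v :
  `|phi v| <= `|phi| * `|v|.
Proof. by have [_ ] := best_constP (@normr_ge0 _ _) (dual_bound phi); exact. Qed.

Lemma dual_comp_bound : exists2 K : R, 0 <= K &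
  forall phi, `|dual_comp phi| <= K * `|phi|.
Proof.
pose l : {linear lip0 o' -> lip0 o} :=
  HB.pack lip0_comp (GRing.isLinear.Build _ _ _ _ _ lip0_comp_linear).
have /linear_boundedP[K [_ Kl]] : bounded_near l (nbhs (0 : lip0 o')).
  by apply/linear_bounded_continuous; exact: lip0_comp_continuous.
have K0 : 0 <= Num.max K 0 + 1 by rewrite addr_ge0// le_max lexx orbT.
exists (Num.max K 0 + 1) => // phi.
apply: best_const_le; split; first by rewrite mulr_ge0.
move=> g /=; rewrite (le_trans (dual_le _ _))// (mulrC _ `|phi|) -mulrA.
by rewrite ler_wpM2l// Kl// ltr_pwDr// le_max lexx.
Qed.

Lemma dual_comp_continuous : continuous dual_comp.
Proof.
pose l : {linear dual (lip0 o) -> dual (lip0 o')} :=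
  HB.pack dual_comp (GRing.isLinear.Build _ _ _ _ _ dual_comp_linear).
apply: (@bounded_linear_continuous _ _ _ l); apply/linear_boundedP.
have [K K0 Kl] := dual_comp_bound.
exists K; split => [|C KC phi]; first exact: num_real.
by rewrite (le_trans (Kl _))// ler_wpM2r// ltW.
Qed.

Lemma free_map_subproof (m : free_space o) : dual_comp m \in free_pred o'.
Proof.
case: m => m /= /[!inE] mF U /dual_comp_continuous/mF[phi [[s ->] Us]].
exists (dual_comp (\sum_(p <- s) p.1 *: delta o p.2)); split => //.
exists [seq (p.1, f p.2) | p <- s]; rewrite big_map /=.
pose l : {linear dual (lip0 o) -> dual (lip0 o')} :=
  HB.pack dual_comp (GRing.isLinear.Build _ _ _ _ _ dual_comp_linear).
rewrite -[dual_comp _]/(l _) linear_sum; apply: eq_bigr => p _.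
by rewrite linearZ/=; congr (_ *: _); exact: val_inj.
Qed.

Definition free_map (m : free_space o) : free_space o' :=
  FreeSpace (free_map_subproof m).

Definition free_extension (T : free_space o -> free_space o') :=
  [/\ linear T, continuous T &
      forall x, T (free_delta o x) = free_delta o' (f x)].

Lemma free_mapP : free_extension free_map.
Proof.
have lT : linear free_map by move=> a m1 m2; do 2 apply: val_inj.
split => //; last by move=> x; do 2 apply: val_inj.
pose l : {linear free_space o -> free_space o'} :=
  HB.pack free_map (GRing.isLinear.Build _ _ _ _ _ lT).
apply: (@bounded_linear_continuous _ _ _ l); apply/linear_boundedP.
have [K K0 Kl] := dual_comp_bound.
exists K; split => [|C KC m]; first exact: num_real.
by rewrite (le_trans (Kl _))// ler_wpM2r// ltW.
Qed.

Lemma free_map_unique T : free_extension T -> T = free_map.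
Proof.
have [lF cF dF] := free_mapP; move=> [lT cT dT].
pose F : {linear free_space o -> free_space o'} :=
  HB.pack free_map (GRing.isLinear.Build _ _ _ _ _ lF).
pose T' : {linear free_space o -> free_space o'} :=
  HB.pack T (GRing.isLinear.Build _ _ _ _ _ lT).
pose D : free_space o -> free_space o' := T \- free_map.
have cD : continuous D.
  by move=> m; apply: (@cvgB _ _ _ (nbhs m)); [exact: cT|exact: cF].
pose sp (s : seq (R * M)) := \sum_(p <- s) p.1 *: free_delta o p.2.
have Dsp s : D (sp s) = 0.
  apply/eqP; rewrite /D subr_eq0 -[T]/(T' : _ -> _) -[free_map]/(F : _ -> _).
  rewrite !linear_sum; apply/eqP/eq_bigr => p _.
  by rewrite !linearZ/= dT dF.
have spE s : free_val (sp s) = \sum_(p <- s) p.1 *: delta o p.2.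
  by rewrite /sp; elim/big_ind2: _ => // ? ? ? ? <- <-.
apply/funext => m; apply/eqP; rewrite -subr_eq0 -/(D m) -normr_eq0.
apply/eqP/le_anti; rewrite normr_ge0 andbT.
apply/ler_addgt0Pl => e e0; rewrite addr0.
have /cvgrPdist_lt/(_ _ e0)/nbhs_ballP[d /= d0 dD] := cD m.
have [_ [[s ->]]] := free_val_closure (nbhsx_ballx (free_val m) d d0).
rewrite -spE -ball_normE /= => ms.
have /dD : ball m d (sp s) by rewrite -ball_normE.
by rewrite /= Dsp subr0 => /ltW.
Qed.

End free_map.

Definition lip_lin_injective {R : realType} {M : metricType R} (o : M) :=
  forall (N : metricType R) (o' : N) (f : M -> N) (fL : lip0_map o o' f),
    complete_space N -> injective f -> injective (free_map fL).

(* Main.v *)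
Require Import Defs.
From HB Require Import structures.
From mathcomp Require Import all_boot all_order all_algebra.
From mathcomp Require Import all_classical all_reals all_analysis.
From mathcomp Require Import lra ring.

Set Implicit Arguments.
Unset Strict Implicit.
Unset Printing Implicit Defensive.

Import Order.TTheory GRing.Theory Num.Theory.
Import numFieldNormedType.Exports.

Local Open Scope classical_set_scope.
Local Open Scope ring_scope.

(* Let [flat_dist x y] be the supremum of [h x - h y] over the locally constant
   1-Lipschitz [h].  By compactness, a function that is Lipschitz for
   [flat_dist] is a uniform limit of locally constant functions with the same
   Lipschitz constant, so an element of the free space that annihilates the
   locally constant functions annihilates it too.  A function with a null image
   is such a function: the image is contained in an open set of small measure,
   which can be collapsed by a map of the line moving no point by much.

   If [flat_dist x y < mdist x y], then at every scale [r] there is a chain from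
   [x] to [y] whose jumps of length at least [r] have total length at most
   [B < mdist x y].  List these jumps by decreasing length and let [r] tend to
   [0]: by compactness one gets points [(a_i, b_i)] with
   [delta x - delta y - \sum_i (delta a_i - delta b_i)] annihilating the locally
   constant functions, a nonzero element since
   [\sum_i mdist a_i b_i <= B].  Hence weak* density forces
   [flat_dist = mdist], which is uniform separation.

   If [M] is totally disconnected, [flat_dist] is a metric, and Lip-lin
   injectivity for the identity from [M] to [M] with the metric [flat_dist] says
   that the [flat_dist]-Lipschitz functions are weak* dense.  Conversely,
   locally constant functions factor through every injective Lipschitz map. *)

(** * Elements of the free space and weak* density *)

Section free_space_facts.
Context {R : realType} {M : metricType R} (o : M).
Implicit Types (m : free_space o) (f g h : lip0 o) (S : set (lip0 o)).

Lemma lip0_of_lipschitz (h : M -> R) (C : R) : 0 <= C ->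
  (forall a b, h a - h b <= C * mdist a b) ->
  exists2 f : lip0 o, `|f| <= C & forall x, f x = h x - h o.
Proof.
move=> C0 hC.
have hCn a b : `|h a - h b| <= C * mdist a b.
  by rewrite ler_norml lerNl opprB hC andbT metric_sym hC.
have hp : (fun x => h x - h o) \in lip0_pred o.
  rewrite inE; split; last by rewrite subrr.
  by exists C => x y; rewrite {1}/mdist/= opprB addrA subrK distrC.
exists (Lip0 hp) => //; apply: best_const_le; split=> // -[a b] /=.
by rewrite opprB addrA subrK.
Qed.

Lemma free_val_span m (e : R) : 0 < e ->
  exists s : seq (R * M),
    forall f, `|m f - \sum_(p <- s) p.1 * f p.2| <= e * `|f|.
Proof.
move=> e0.
have [_ [[s ->]]] := free_val_closure (nbhsx_ballx (free_val m) e e0).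
rewrite -ball_normE /= => ms; exists s => f.
have -> : \sum_(p <- s) p.1 * f p.2 =
    (\sum_(p <- s) p.1 *: delta o p.2 : dual (lip0 o)) f.
  by elim/big_ind2: _ => // ? ? ? ? -> ->.
by rewrite (le_trans (dual_le (free_val m - _) f))// ler_wpM2r// ltW.
Qed.

Lemma free_eq0 m : (forall f, m f = 0) -> m = 0.
Proof. by move=> m0; apply/val_inj/val_inj/funext => f; exact: m0. Qed.

(** Tolerance 1 already makes [phi] bounded; small tolerances put it in the closure of the span. *)
Lemma free_of_functional (phi : lip0 o -> R^o) : linear phi ->
  (forall e, 0 < e -> exists s : seq (R * M),
    forall f, `|phi f - \sum_(p <- s) p.1 * f p.2| <= e * `|f|) ->
  exists m, forall f, m f = phi f.
Proof.
move=> lphi aphi.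
have sE s f : (\sum_(p <- s) p.1 *: delta o p.2 : dual (lip0 o)) f =
    \sum_(p <- s) p.1 * f p.2.
  by elim/big_ind2: _ => // ? ? ? ? <- <-.
have phip : phi \in dual_pred (lip0 o).
  rewrite inE; split => //.
  pose l : {linear lip0 o -> R^o} :=
    HB.pack phi (GRing.isLinear.Build _ _ _ _ _ lphi).
  apply: (@bounded_linear_continuous _ _ _ l); apply/linear_boundedP.
  have [s sP] := aphi 1 ltr01.
  pose D : dual (lip0 o) := \sum_(p <- s) p.1 *: delta o p.2.
  exists (1 + `|D|); split => [|C DC f]; first exact: num_real.
  rewrite (le_trans _ (ler_wpM2r _ (ltW DC)))// mulrDl.
  rewrite -[l f](subrK (D f)) (le_trans (ler_normD _ _))// lerD ?dual_le//.
  by rewrite /D sE.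
have phiF : Dual phip \in free_pred o.
  rewrite inE => U /nbhs_ballP[e /= e0 eU].
  have [s sP] := aphi (e / 2) (divr_gt0 e0 (ltr0n _ 2)).
  exists (\sum_(p <- s) p.1 *: delta o p.2); split; first by exists s.
  apply: eU; rewrite -ball_normE /=.
  apply: (@le_lt_trans _ _ (e / 2));
    last by rewrite ltr_pdivrMr// ltr_pMr// ltr1n.
  apply: best_const_le; split => [|f]; first by rewrite divr_ge0// ltW.
  by have := sP f; rewrite -sE.
by exists (FreeSpace phiF).
Qed.

(** Up to a remainder of small norm, tested on functions of bounded Lipschitz norm, [m] is a finite
    combination of evaluations, which sees only the uniform error. *)
Lemma free_eq0_approx m g (C : R) :
  (forall e, 0 < e -> exists h,
    [/\ `|h| <= C, m h = 0 & forall x, `|h x - g x| <= e]) -> m g = 0.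
Proof.
move=> gP; apply/eqP; rewrite -normr_le0; apply/ler_addgt0Pr => e e0;
  rewrite add0r.
have C0 : 0 <= C by have [h [hC _ _]] := gP 1 ltr01; exact: le_trans hC.
(* [K] bounds the norm of [g - h] and [A] the coefficients; each part then costs at most [e / 2]. *)
pose K := `|g| + C + 1.
have K0 : 0 < K by rewrite ltr_wpDl// addr_ge0.
have [s sP] := @free_val_span m (e / K / 2) (divr_gt0 (divr_gt0 e0 K0) (ltr0n _
  2)).
pose A := \sum_(p <- s) `|p.1| + 1.
have A0 : 0 < A by rewrite ltr_wpDl// sumr_ge0.
have [h [hC mh hg]] := gP (e / A / 2) (divr_gt0 (divr_gt0 e0 A0) (ltr0n _ 2)).
have mgh : m g = m (g - h).
  by rewrite -[g - h]addrC -scaleN1r dual_linear mh scaler0 add0r.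
rewrite mgh -[m _](subrK (\sum_(p <- s) p.1 * (g - h) p.2)).
rewrite (le_trans (ler_normD _ _))// [leRHS]splitr lerD//.
  rewrite (le_trans (sP _))// mulrAC ler_pM2r ?invr_gt0//.
  rewrite -mulrA ler_piMr ?(ltW e0)// mulrC ler_pdivrMr// mul1r.
  by rewrite (le_trans (ler_normB _ _))// /K -addrA lerD2l ler_wpDr.
rewrite (le_trans (ler_norm_sum _ _ _))//.
apply: (@le_trans _ _ (A * (e / A / 2))).
  rewrite mulrDl mulr_suml ler_wpDr ?mul1r ?divr_ge0 ?(ltW e0) ?(ltW A0)//.
  by apply: ler_sum => p _; rewrite normrM ler_wpM2l//; have := hg p.2;
    rewrite distrC.
by rewrite mulrA mulrCA divff ?gt_eqF// mulr1.
Qed.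

(** The pre-annihilator of [S] is zero, which for linear [S] amounts to weak* density. *)
Definition separates_free S :=
  forall m : free_space o, (forall f, S f -> m f = 0) -> m = 0.

(** The set where [m] is nonzero is weak* open, so a dense [S] meets it unless it is empty. *)
Lemma weak_star_dense_separates_free S : weak_star_dense S -> separates_free S.
Proof.
move=> dS m mS; apply: free_eq0 => f; apply: contrapT => /eqP mf.
pose U : set (weak_star o) := [set g : lip0 o | m g != 0].
have oU : open U.
  have cm : continuous (fun g : weak_star o => m g : R^o).
    move=> g; apply: (@continuous_comp (weak_star o) {ptws free_space o -> R^o}
      R^o (fun f0 : lip0 o =>
        (fun m0 => free_val m0 f0) : {ptws free_space o -> R^o})
      (fun F => F m)); first exact: initial_continuous.
    exact: proj_continuous.
  rewrite (_ : U = (fun g : weak_star o => m g : R^o) @^-1` [set r | r != 0])//.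
  apply: open_comp; first by move=> g _; exact: cm.
  exact: open_neq.
have [|g [Ug Sg]] := dS U _ oU; first by exists f.
by move: Ug; rewrite /U/= mS// eqxx.
Qed.

Definition linear_set S :=
  S (0 : lip0 o) /\ forall (a : R) f g, S f -> S g -> S (a *: f + g).

(* A finite-dimensional separation argument, by induction on the number of
   functionals: if [m] does not vanish on [S], say [m h = 1], then the problem
   for [m :: ms] reduces to the one for [ms] on the kernel of [m] in [S]. *)
Lemma subspace_interpolation (ms : seq (free_space o)) S f : linear_set S ->
  (exists2 g, S g & forall m, m \in ms -> m g = m f) \/
  (exists2 m : free_space o, (forall g, S g -> m g = 0) & m f <> 0).
Proof.
elim: ms S f => [|m ms ih] S f Ssub.
  by left; exists (0 : lip0 o) => //; case: Ssub.
have [S0 Slin] := Ssub.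
have [mS|/existsNP[h /not_implyP[Sh mh]]] := pselect (forall g, S g -> m g = 0).
  have [mf|mf] := eqVneq (m f) 0; last by right; exists m => //; exact/eqP.
  have [[g Sg gP]|] := ih S f Ssub; last by right.
  left; exists g => // m'; rewrite inE => /predU1P[->|/gP//].
  by rewrite mf mS.
move/eqP in mh.
have mZ (m1 : free_space o) a u v : m1 (a *: u + v) = a * m1 u + m1 v.
  exact: dual_linear.
pose k := (m h)^-1 *: h.
have Sk : S k by rewrite /k -[_ *: _]addr0; exact: Slin.
have mk : m k = 1.
  have := mZ m (m h)^-1 h 0; rewrite addr0 -/k => ->.
  by have := mZ m (-1) 0 0; rewrite scaler0 addr0 => /eqP;
    rewrite mulN1r addNr => /eqP ->; rewrite addr0 mulVf.
have S'sub : linear_set (S `&` [set g | m g = 0]).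
  split.
    split => //=; have := mZ m (-1) 0 0.
    by rewrite scaler0 addr0 mulN1r addNr.
  by move=> a u v [Su mu] [Sv mv]; split;
    [exact: Slin|rewrite /= mZ mu mv mulr0 addr0].
have [[g [Sg mg] gP]|[b bS bf]] := ih _ (- m f *: k + f) S'sub.
  left; exists (m f *: k + g); first exact: Slin.
  move=> m'; rewrite inE => /predU1P[->|/gP]; rewrite mZ.
    by rewrite mk mg mulr1 addr0.
  by rewrite mZ => ->; rewrite mulNr addNKr.
(* Subtracting the multiple of [m] that agrees with [b] at [k] turns vanishing on the kernel of [m]
   in [S] into vanishing on [S]. *)
right; exists (- b k *: m + b) => [g Sg|].
  have : b (- m g *: k + g) = 0.
    by apply: bS; split; [exact: Slin|rewrite /= mZ mk mulr1 addNr].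
  by rewrite mZ => <-; rewrite /= mulNr mulrC -mulNr.
have -> : (- b k *: m + b) f = - b k * m f + b f by [].
by move: bf; rewrite mZ !mulNr mulrC.
Qed.

(** The elements of [S] that agree with [f] on a finite list of functionals form a filter base
    converging weak* to [f]; interpolation makes its members nonempty. *)
Lemma separates_free_weak_star_dense S : linear_set S ->
  separates_free S -> weak_star_dense S.
Proof.
move=> Ssub annS O [f Of] oO.
pose B (ms : seq (free_space o)) : set (weak_star o) :=
  [set g : lip0 o | S g /\ forall m, m \in ms -> m g = m f].
pose F : set_system (weak_star o) := filter_from setT B.
have FF : ProperFilter F.
  apply: filter_from_proper.
    apply: filter_from_filter; first by exists [::].
    move=> ms1 ms2 _ _; exists (ms1 ++ ms2) => // g [Sg gP].
    by split; split => // m mm; apply: gP; rewrite mem_cat mm ?orbT.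
  move=> ms _; have [[g Sg gP]|[m mS []]] := subspace_interpolation ms f Ssub.
    by exists g.
  by rewrite (annS m mS).
have Ff : F --> (f : weak_star o).
  move=> U [V [[W oW <-]] Wf WU].
  have evF : (fun g : weak_star o => (fun m => free_val m g) :
      {ptws free_space o -> R^o}) @ F -->
      ((fun m => free_val m f) : {ptws free_space o -> R^o}).
    apply/pointwise_cvgP.
    move=> m A Am; exists [:: m] => // g [_ gP] /=.
    by rewrite gP ?mem_seq1//; exact: nbhs_singleton.
  have : nbhs (F : set_system (weak_star o)) ((fun f m =>
    free_val m f : R^o) @^-1` W).
    by apply: evF; exact: open_nbhs_nbhs.
  exact: filterS.
have [ms _ msO] : F O by apply: Ff; exact: open_nbhs_nbhs.
have [[g Sg gP]|[m mS []]] := subspace_interpolation ms f Ssub.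
  by exists g; split => //; exact: msO.
by rewrite (annS m mS).
Qed.

End free_space_facts.

(** * The flat distance and its approximations at positive scales *)

Section flat_distance.
Context {R : realType} {M : metricType R}.
Implicit Types (x y z : M) (e : R) (h : M -> R).

(** The scale [e] quantifies local constancy: on a compact space a locally constant function is
    constant at some positive scale. *)
Definition flat_at e : set (M -> R) := [set h |
  (forall a b, h a - h b <= mdist a b) /\
  forall a b, mdist a b < e -> h a = h b].

Definition flat_dist_at e x y : R := sup [set h x - h y | h in flat_at e].

Definition flat_dist x y : R :=
  sup [set flat_dist_at e x y | e in [set e | 0 < e]].

Lemma flat_dist_at_ge e h x y : flat_at e h -> h x - h y <= flat_dist_at e x y.
Proof.
move=> hH; apply: ub_le_sup; last by exists h.
by exists (mdist x y) => _ [k [kH _] <-].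
Qed.

Lemma flat_dist_at_le e x y B :
  (forall h, flat_at e h -> h x - h y <= B) -> flat_dist_at e x y <= B.
Proof.
move=> hB; apply: ge_sup; last by move=> _ [k kH <-]; exact: hB.
exists 0, (fun=> 0); last by rewrite subrr.
by split => // a b; rewrite subrr mdist_ge0.
Qed.

Lemma flat_dist_at_le_mdist e x y : flat_dist_at e x y <= mdist x y.
Proof. by apply: flat_dist_at_le => h [+ _]; exact. Qed.

Lemma flat_dist_at_ge0 e x y : 0 <= flat_dist_at e x y.
Proof.
rewrite -(subrr 0); apply: (@flat_dist_at_ge e (fun=> 0)).
by split => // a b; rewrite subrr mdist_ge0.
Qed.

Lemma flat_dist_at_eq0 e x y : mdist x y < e -> flat_dist_at e x y = 0.
Proof.
move=> xy; apply/eqP; rewrite eq_le flat_dist_at_ge0 andbT.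
by apply: flat_dist_at_le => h [_ /(_ _ _ xy)->]; rewrite subrr.
Qed.

Lemma flat_dist_at_sym e x y : flat_dist_at e x y = flat_dist_at e y x.
Proof.
wlog suff : x y / flat_dist_at e x y <= flat_dist_at e y x.
  by move=> le; apply/eqP; rewrite eq_le !le.
apply: flat_dist_at_le => h [h1 h2].
have -> : h x - h y = - h y - - h x by rewrite opprK addrC.
apply: (@flat_dist_at_ge e (fun z => - h z)); split => a b.
  by rewrite opprK addrC metric_sym.
by move=> /h2->.
Qed.

Lemma flat_dist_at_triangle e y x z :
  flat_dist_at e x z <= flat_dist_at e x y + flat_dist_at e y z.
Proof.
apply: flat_dist_at_le => h hH; rewrite -(subrK (h y) (h x)) -addrA.
by rewrite lerD ?flat_dist_at_ge.
Qed.

(** The triangle inequality makes this function admissible; for [e > 0] it is extremal. *)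
Lemma flat_at_dist e x : flat_at e (flat_dist_at e x).
Proof.
have key a b : flat_dist_at e x a - flat_dist_at e x b <= flat_dist_at e b a.
  by rewrite lerBlDl flat_dist_at_triangle.
split => a b.
  by rewrite (le_trans (key _ _))// metric_sym flat_dist_at_le_mdist.
move=> ab; apply/eqP; rewrite eq_le -subr_le0 (le_trans (key _ _)).
  by rewrite -subr_le0 (le_trans (key _ _))// flat_dist_at_eq0.
by rewrite flat_dist_at_eq0// metric_sym.
Qed.

Lemma le_flat_dist_at e e' x y : e <= e' ->
  flat_dist_at e' x y <= flat_dist_at e x y.
Proof.
move=> ee'; apply: flat_dist_at_le => h [h1 h2]; apply: flat_dist_at_ge.
by split => // a b ab; apply: h2; exact: lt_le_trans ee'.
Qed.

Lemma flat_dist_at_le_flat_dist e x y : 0 < e ->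
  flat_dist_at e x y <= flat_dist x y.
Proof.
move=> e0; apply: ub_le_sup; last by exists e.
by exists (mdist x y) => _ [e' _ <-]; exact: flat_dist_at_le_mdist.
Qed.

Lemma flat_dist_le x y B :
  (forall e, 0 < e -> flat_dist_at e x y <= B) -> flat_dist x y <= B.
Proof.
move=> eB; apply: ge_sup; last by move=> _ [e e0 <-]; exact: eB.
by exists (flat_dist_at 1 x y), 1 => /=.
Qed.

Lemma flat_dist_le_mdist x y : flat_dist x y <= mdist x y.
Proof. by apply: flat_dist_le => e _; exact: flat_dist_at_le_mdist. Qed.

Lemma flat_dist_ge0 x y : 0 <= flat_dist x y.
Proof.
exact: le_trans (flat_dist_at_ge0 1 x y) (flat_dist_at_le_flat_dist x y ltr01).
Qed.

Lemma flat_dist_sym x y : flat_dist x y = flat_dist y x.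
Proof.
by rewrite /flat_dist; congr (sup (_ @` _)); apply/funext => e;
  exact: flat_dist_at_sym.
Qed.

Lemma flat_dist_triangle y x z : flat_dist x z <= flat_dist x y + flat_dist y z.
Proof.
apply: flat_dist_le => e e0;
  rewrite (le_trans (flat_dist_at_triangle e y x z))//.
by rewrite lerD ?flat_dist_at_le_flat_dist.
Qed.

Lemma flat_distxx x : flat_dist x x = 0.
Proof.
by apply/eqP; rewrite eq_le flat_dist_ge0 (le_trans (flat_dist_le_mdist x x))//
  mdistxx.
Qed.

Lemma flat_dist_gt x y r : r < flat_dist x y ->
  exists2 e, 0 < e & r < flat_dist_at e x y.
Proof.
move=> rxy; apply: contrapT => no; move: rxy; rewrite ltNge => /negP; apply.
by apply: flat_dist_le => e e0; rewrite leNgt; apply/negP => re; apply: no;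
  exists e.
Qed.

Hypothesis M_compact : compact [set: M].

(** A Dini argument: the distances at scale [r] increase to [flat_dist] as [r] decreases, and
    domination by [mdist] spreads the estimate at one pair to a neighbourhood. *)
Lemma flat_dist_uniform e : 0 < e ->
  exists2 r, 0 < r & forall x y, flat_dist x y <= flat_dist_at r x y + e.
Proof.
move=> e0.
have /compact_near_coveringP cMM := compact_setX M_compact M_compact.
(* An error [e / 2] at the centre and four displacements below [e / 8] add up to [e]. *)
have e80 : 0 < e / 8 by rewrite divr_gt0.
have : \forall r \near (0:R)^'+, [set: M] `*` [set: M] `<=`
    [set p | flat_dist p.1 p.2 <= flat_dist_at r p.1 p.2 + e].
  apply: cMM => -[x y] _.
  have [|r r0 rxy] := @flat_dist_gt x y (flat_dist x y - e / 2).
    by rewrite ltrBlDr ltrDl divr_gt0.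
  exists (ball x (e / 8) `*` ball y (e / 8), [set r' | 0 < r' <= r]).
    split => /=; first by exists (ball x (e / 8), ball y (e / 8)) => //;
      split; exact: (nbhsx_ballx _ _ e80).
    by near=> r'; apply/andP; split => //; near: r'; exact: nbhs_right_le.
  move=> [[x' y'] r'] [/= [xx' yy'] /andP[r'0 r'r]].
  move: xx' yy'; rewrite !ballEmdist /= => xx' yy'.
  have := flat_dist_triangle x x' y'; have := flat_dist_triangle y x y'.
  have := flat_dist_at_triangle r' x' x y;
    have := flat_dist_at_triangle r' y' x' y.
  have := le_flat_dist_at x y r'r.
  have := flat_dist_at_le_mdist r' x x'; have := flat_dist_at_le_mdist r' y' y.
  have := flat_dist_le_mdist x' x; have := flat_dist_le_mdist y y'.
  move: xx' yy' rxy; rewrite ![mdist _ x]metric_sym ![mdist _ y]metric_sym; lra.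
move=> /(filterI (nbhs_right_gt (0:R)))/filter_ex[r [r0 rP]].
by exists r => // x y; exact: (rP (x, y)).
Unshelve. all: by end_near. Qed.

End flat_distance.

Lemma inf_range_le {R : realType} {I : Type} (i0 : I) (F G : I -> R) (B C : R) :
  (forall i, B <= F i) -> (forall i, exists j, F j <= G i + C) ->
  inf (range F) <= inf (range G) + C.
Proof.
move=> BF FG; rewrite -lerBlDr; apply: lb_le_inf; first by exists (G i0), i0.
move=> _ [i _ <-]; rewrite lerBlDr; have [j] := FG i; apply: le_trans.
by apply: ge_inf; [exists B => _ [k _ <-]|exists j].
Qed.

(** * Collapsing a null set of the line *)

Section null_set_flattening.
Context {R : realType}.
Local Notation mR := (measurableTypeR R).
Local Notation mu := (@lebesgue_measure R).

(** With [U] open around [K] and of measure below [e], let [psi t] be [t] minus the measure of the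
    part of [U] left of [t]: this collapses [U] and loses at most [e]. *)
Lemma null_set_flattening (K : set mR) (e : R) :
  measurable K -> lebesgue_measure K = 0%E -> 0 < e ->
  exists U : set R, exists psi : R -> R, [/\ open U, K `<=` U,
    forall s t, s <= t -> Num.max 0 (t - s - e) <= psi t - psi s <= t - s &
    forall s t, s <= t -> `[s, t] `<=` U -> psi s = psi t].
Proof.
move=> mK K0 e0.
have [|U [oU KU UKe]] := @lebesgue_regularity_outer R K e mK _ e0.
  by rewrite [X in (X < _)%E]K0 ltry.
have mU : measurable (U : set mR) by exact: measurable_realfun.open_measurable.
have Ue : (mu U < e%:E)%E.
  rewrite -(setDUK KU) measureU ?setDIK//; last exact: measurableD.
  by rewrite [X in (X + _)%E]K0 add0e.
pose chi t := fine (mu (U `&` `]-oo, t])).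
have mUt t : measurable (U `&` `]-oo, t] : set mR) by exact: measurableI.
have mUst s t : measurable (U `&` `]s, t] : set mR) by exact: measurableI.
have le_mu (A B : set mR) : measurable A -> measurable B -> A `<=` B ->
    (mu A <= mu B)%E.
  by move=> mA mB; apply: le_measure; rewrite inE.
have fU (A : set mR) : measurable A -> A `<=` U -> mu A \is a fin_num.
  move=> mA AU; rewrite ge0_fin_numE// (@le_lt_trans _ _ (mu U))//;
    first exact: le_mu.
  by rewrite (lt_trans Ue)// ltry.
have chiE s t : s <= t -> chi t - chi s = fine (mu (U `&` `]s, t])).
  move=> st; rewrite /chi.
  have -> : `]-oo, t]%classic = `]-oo, s] `|` `]s, t].
    apply/seteqP; split => x /=; rewrite !in_itv/=; last first.
      by case=> [/le_trans|/andP[_]//]; apply.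
    by move=> xt; have [xs|xs] := leP x s; [left|right; rewrite xt].
  rewrite setIUr [mu _](_ : _ = mu (U `&` `]-oo, s]) + mu (U `&` `]s, t]))%E.
    have fs := fU _ (mUt s) (@subIsetl _ _ _).
    have fst_ := fU _ (mUst s t) (@subIsetl _ _ _).
    by rewrite (fineD fs fst_) addrC addKr.
  apply: measureU; [exact: mUt|exact: mUst|].
  apply/seteqP; split => // x /= -[[_ +] [_ +]]; rewrite !in_itv/=.
  by move=> xs /andP[/lt_le_trans/(_ xs)]; rewrite ltxx.
have mu_itv (s t : R) : s <= t -> mu (`]s, t]%classic : set R) = (t - s)%:E.
  move=> st; apply: (etrans (lebesgue_measure_itv `]s, t])) => /=;
    rewrite lte_fin EFinB.
  by case: ltgtP st => // -> _; rewrite -EFinB subrr.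
exists U, (fun t => t - chi t); split => // [s t st|s t st stU].
  have -> : t - chi t - (s - chi s) = t - s - (chi t - chi s) by ring.
  have c0 : 0 <= chi t - chi s by rewrite chiE// fine_ge0.
  have cst : chi t - chi s <= t - s.
    rewrite chiE// -lee_fin fineK -?mu_itv//;
      last exact: (fU _ (mUst s t) (@subIsetl _ _ _)).
    by apply: le_mu => //; exact: subIsetr.
  have ce : chi t - chi s <= e.
    rewrite chiE// -lee_fin fineK;
      last exact: (fU _ (mUst s t) (@subIsetl _ _ _)).
    rewrite (le_trans _ (ltW Ue))//.
    by apply: le_mu => //; exact: subIsetl.
  by rewrite ge_max; apply/andP; split; [apply/andP; split|]; lra.
have := chiE _ _ st; rewrite setIidr.
  by rewrite mu_itv//= => chist; apply/eqP; rewrite -subr_eq0; apply/eqP; lra.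
by apply: subset_trans stU => x /=; rewrite !in_itv/= => /andP[/ltW -> ->].
Qed.

End null_set_flattening.

(** * Null images and approximation by locally constant functions *)

Section compact_flat_distance.
Context {R : realType} {M : metricType R} (o : M).
Hypothesis M_compact : compact [set: M].

Lemma locally_constant_scale (T : Type) (f : M -> T) :
  (forall x, \forall y \near x, f y = f x) ->
  exists2 r : R, 0 < r & forall a b, mdist a b < r -> f a = f b.
Proof.
move=> lcf; have /compact_near_coveringP cM := M_compact.
have : \forall r \near (0:R)^'+, [set: M] `<=`
    [set a | forall b, mdist a b < r -> f a = f b].
  apply: cM => x _; have /nbhs_ballP[d /= d0 df] := lcf x.
  have d20 : 0 < d / 2 by rewrite divr_gt0.
  exists (ball x (d / 2), [set r' | r' <= d / 2]).
    by split; [exact: nbhsx_ballx|exact: nbhs_right_le].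
  move=> [x' r'] [/=]; rewrite ballEmdist /= => xx' r'd b x'b.
  rewrite (df x') ?(df b)// ballEmdist/=; last by lra.
  by have := metric_triangle x x' b; lra.
move=> /(filterI (nbhs_right_gt (0:R)))/filter_ex[r [r0 rP]].
by exists r => // a b; exact: rP.
Qed.

Lemma flat_dist_at_geM (L r : R) (h : M -> R) x y : 0 <= L ->
  (forall a b, h a - h b <= L * mdist a b) ->
  (forall a b, mdist a b < r -> h a = h b) ->
  h x - h y <= L * flat_dist_at r x y.
Proof.
rewrite le_eqVlt => /predU1P[<-|L0] hL hr.
  by rewrite mul0r -(mul0r (mdist x y)).
rewrite -ler_pdivrMl// mulrBr;
  apply: (@flat_dist_at_ge _ _ _ (fun x => L^-1 * h x)).
split => [a b|a b /hr->//].
by rewrite -mulrBr ler_pdivrMl.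
Qed.

Lemma lip0_sub_le (f : lip0 o) x y : f x - f y <= `|f| * mdist x y.
Proof. exact: le_trans (ler_norm _) (lip0_le f x y). Qed.

(** After composition with a map [psi] collapsing a neighbourhood of its image, [f] is constant at a
    small scale, its Lipschitz bound is kept, and differences shrink by at most [e]. *)
Lemma null_image_flat_lipschitz (f : lip0 o) x y :
  null_image_lip0 f -> f x - f y <= `|f| * flat_dist x y.
Proof.
move=> f0; apply/ler_addgt0Pr => e e0.
have [fxy|fyx] := leP (f x) (f y).
  rewrite (@le_trans _ _ 0) ?subr_le0// addr_ge0 ?(ltW e0)// mulr_ge0//.
  exact: flat_dist_ge0.
have cf : continuous (f : M -> R^o).
  move=> z; apply/cvgrPdist_le => d d0.
  have C0 : 0 < `|f| + 1 by rewrite ltr_wpDl.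
  apply/nbhs_ballP; exists (d / (`|f| + 1)); first by rewrite /= divr_gt0.
  move=> z'; rewrite ballEmdist /= ltr_pdivlMr// => zz'.
  rewrite (le_trans (lip0_le f z z'))// (le_trans _ (ltW zz'))//.
  by rewrite mulrC ler_wpM2l ?mdist_ge0// lerDl.
have cK : compact (range f : set R).
  by apply: (@continuous_compact M R^o f) => //; exact: continuous_subspaceT.
have mK : measurable (range f : set R).
  by apply: measurable_realfun.closed_measurable; apply: compact_closed cK;
    exact: Rhausdorff.
have [U [psi [oU fU psiI psiU]]] := null_set_flattening mK f0 e0.
have psiL s t : psi s - psi t <= `|s - t|.
  have [st|ts] := leP s t.
    have /andP[+ _] := psiI _ _ st; rewrite ge_max => /andP[+ _].
    by have := normr_ge0 (s - t); lra.
  by have /andP[_ +] := psiI _ _ (ltW ts); rewrite gtr0_norm ?subr_gt0.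
(* For [a] and [b] close, both values of [f] lie in one interval inside [U], hence so does
   everything between them. *)
have [r r0 rP] : exists2 r, 0 < r & forall a b, mdist a b < r ->
    forall s, f a <= s <= f b -> U s.
  have /compact_near_coveringP cM := M_compact.
  have : \forall r \near (0:R)^'+, [set: M] `<=`
    [set a | forall b, mdist a b < r -> forall s, f a <= s <= f b -> U s].
    apply: cM => z _.
    have /nbhs_ballP[d /= d0 dU] : nbhs (f z : R) U.
      by apply: open_nbhs_nbhs; split => //; apply: fU; exists z.
    have : \forall z' \near z, ball (f z : R) d (f z').
      by apply: cf; exact: nbhsx_ballx.
    move=> /nbhs_ballP[c /= c0 cd].
    have c20 : 0 < c / 2 by rewrite divr_gt0.
    exists (ball z (c / 2), [set r' | r' <= c / 2]).
      by split; [exact: nbhsx_ballx|exact: nbhs_right_le].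
    move=> [a r'] [/=]; rewrite ballEmdist /= => za r'c b ab s /andP[fas sfb].
    have /cd : ball z c a by rewrite ballEmdist/=; lra.
    have /cd : ball z c b.
      by rewrite ballEmdist/=; have := metric_triangle z a b; lra.
    rewrite -!ball_normE /= !ltr_distl => /andP[b1 b2] /andP[a1 a2].
    by apply: dU; rewrite -ball_normE/= ltr_distl; apply/andP; split; lra.
  move=> /(filterI (nbhs_right_gt (0:R)))/filter_ex[r [r0 rP]].
  by exists r => // a b ab s; exact: (rP a).
have : psi (f x) - psi (f y) <= `|f| * flat_dist_at r x y.
  apply: (@flat_dist_at_geM _ _ (psi \o f)) => // [a b|a b ab] /=.
    exact: le_trans (psiL _ _) (lip0_le f a b).
  wlog fab : a b ab / f a <= f b.
    move=> H; have [/H->//|/ltW/H->//] := leP (f a) (f b).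
    by rewrite metric_sym.
  by apply: psiU => // s; rewrite /= in_itv; exact: (rP a b ab).
have /andP[+ _] := psiI _ _ (ltW fyx); rewrite ge_max => /andP[_ psixy] psir.
have : `|f| * flat_dist_at r x y <= `|f| * flat_dist x y.
  by rewrite ler_wpM2l// flat_dist_at_le_flat_dist.
by lra.
Qed.

(** The infimal convolution of [g] with [L * flat_dist_at r] is flat below [r], and it stays near
    [g] because [flat_dist_at r] is uniformly close to [flat_dist]. *)
Lemma flat_lipschitz_approx (g : lip0 o) (L e : R) : 0 <= L -> 0 < e ->
  (forall x y, g x - g y <= L * flat_dist x y) ->
  exists h : lip0 o, [/\ locally_constant_lip0 h, `|h| <= L &
    forall x, `|h x - g x| <= e].
Proof.
move=> L0 e0 gL.
have L10 : 0 < L + 1 by rewrite ltr_wpDl.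
(* Dividing by [L + 1] instead of [L] covers [L = 0]. *)
have [r r0 rP] := flat_dist_uniform M_compact (divr_gt0 e0 L10).
pose F x z := g z + L * flat_dist_at r z x.
pose k x := inf (range (F x)).
have Le : L * (e / (L + 1)) <= e.
  by rewrite mulrCA ger_pMr// ler_pdivrMr// mul1r lerDl.
have Fge x z : g x - e <= F x z.
  have := gL x z; rewrite flat_dist_sym /F.
  have := ler_wpM2l L0 (rP z x); rewrite mulrDr; lra.
have kle x : k x <= g x.
  apply: ge_inf; first by exists (g x - e) => _ [z _ <-].
  by exists x => //; rewrite /F flat_dist_at_eq0 ?mdistxx// mulr0 addr0.
have kge x : g x - e <= k x.
  by apply: lb_le_inf; [exists (F x o), o|move=> _ [z _ <-]].
have kk a b : k a - k b <= L * flat_dist_at r a b.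
  rewrite lerBlDl; apply: (inf_range_le o (Fge a)) => z; exists z.
  rewrite /F -addrA lerD2l -mulrDr ler_wpM2l//.
  by rewrite (flat_dist_at_sym r a b) flat_dist_at_triangle.
have [|h hL hE] := @lip0_of_lipschitz _ _ o k L L0.
  by move=> a b; rewrite (le_trans (kk a b))// ler_wpM2l//
    flat_dist_at_le_mdist.
exists h; split => // [x|x].
  apply/nbhs_ballP; exists r => // y; rewrite ballEmdist /= => xy.
  have yx : mdist y x < r by rewrite metric_sym.
  have := kk x y; have := kk y x; rewrite !hE !flat_dist_at_eq0// mulr0; lra.
(* [k - g] lies in [[-e, 0]] at [x] and at [o], so subtracting [k o] keeps the error within [e]. *)
have := kle x; have := kge x; have := kle o; have := kge o.
by rewrite hE ler_norml lip0_base; lra.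
Qed.
End compact_flat_distance.

Lemma sum_nat_stable {V : zmodType} (F : nat -> V) (m n : nat) :
  (forall i, (minn m n <= i)%N -> F i = 0) ->
  \sum_(0 <= i < m) F i = \sum_(0 <= i < n) F i.
Proof.
wlog mn : m n / (m <= n)%N => [H F0|].
  by case/orP: (leq_total m n) => [/H->//|/H->//]; rewrite minnC.
rewrite (minn_idPl mn) => F0; rewrite [RHS](@big_cat_nat _ _ _ m)//=.
rewrite [X in _ + X]big_nat_cond [X in _ + X]big1 ?addr0// => i.
by rewrite andbT => /andP[/F0].
Qed.

(** * Jumps of chains and their limit at vanishing scale *)

Section gap_lists.
Context {R : realType} {M : metricType R}.
Implicit Types (x y z : M) (r : R) (h : M -> R) (s : seq (M * M)).

(* [s] is the list of the jumps of length at least [r] of some chain from [x]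
   to [y]. *)
Definition gap_list r x y s :=
  forall h, (forall a b, mdist a b < r -> h a = h b) ->
  h x - h y = \sum_(p <- s) (h p.1 - h p.2).

(* The least total length of a gap list to [y] is flat at scale [r], whence the
   duality with [flat_dist_at]. *)
Lemma gap_list_exists r x y B : flat_dist_at r x y < B ->
  exists2 s, gap_list r x y s & \sum_(p <- s) mdist p.1 p.2 < B.
Proof.
pose L z := [set \sum_(p <- s) mdist p.1 p.2 | s in gap_list r z y].
have L0 z : lbound (L z) 0.
  by move=> _ [s _ <-]; apply: sumr_ge0 => p _; exact: mdist_ge0.
have Lne z : L z !=set0.
  exists (\sum_(p <- [:: (z, y)]) mdist p.1 p.2), [:: (z, y)] => //.
  by move=> h _; rewrite big_seq1.
have Ly : inf (L y) = 0.
  apply/eqP; rewrite eq_le lb_le_inf// andbT;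
    apply: (ge_inf (ex_intro _ 0 (L0 y))).
  by exists [::]; [move=> h _|]; rewrite big_nil// subrr.
have flatL : flat_at r (fun z => inf (L z)).
  split=> [a b|a b ab].
    rewrite lerBlDl -lerBlDr; apply: lb_le_inf => // _ [s sg <-].
    rewrite lerBlDr; apply: (ge_inf (ex_intro _ 0 (L0 a))).
    exists ((a, b) :: s); last by rewrite big_cons addrC.
    by move=> h hr; rewrite big_cons -sg//= addrA subrK.
  (* Moves shorter than [r] are not recorded, so [a] and [b] have the same gap lists to [y]. *)
  congr inf; apply/seteqP; split => _ [s sg <-]; exists s => // h hr.
    by rewrite -(hr _ _ ab) sg.
  by rewrite (hr _ _ ab) sg.
move=> xyB; have /inf_lt : inf (L x) < B.
  by rewrite (le_lt_trans _ xyB)// -[leLHS]subr0 -Ly;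
    exact: (@flat_dist_at_ge _ _ r (fun z => inf (L z))).
by move=> /(_ (Lne x))[_ [s sg <-] sB]; exists s.
Qed.

(** In decreasing order, jump [n] has length at most [B / (n + 1)]. A function constant at scale
    [r'] thus sees only jumps below an index that depends on [B] and [r'] but not on [r], which is
    what survives the limit. *)
Lemma gap_sequence_exists r x y B : flat_dist_at r x y < B ->
  exists w : nat -> M * M, [/\
    forall n, \sum_(0 <= i < n) mdist (w i).1 (w i).2 <= B,
    forall n, mdist (w n).1 (w n).2 * n.+1%:R <= B &
    forall h r' n, r <= r' -> (forall a b, mdist a b < r' -> h a = h b) ->
      B < r' * n.+1%:R ->
      h x - h y = \sum_(0 <= i < n) (h (w i).1 - h (w i).2)].
Proof.
move=> /gap_list_exists[s sg /ltW sB].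
pose d (p : M * M) := mdist p.1 p.2.
pose leT p q := d q <= d p.
(* The default [(x, x)] pads the list with jumps of length 0, on which all increments vanish. *)
pose w := nth (x, x) (sort leT s).
have wsum (F : M * M -> R) : \sum_(0 <= i < size s) F (w i) = \sum_(p <- s) F p.
  rewrite -(perm_big _ (permEl (perm_sort leT s)))/=.
  by rewrite [RHS](big_nth (x, x)) size_sort.
have w0 i : (size s <= i)%N -> w i = (x, x).
  by move=> si; rewrite /w nth_default// size_sort.
have d0 p : 0 <= d p by exact: mdist_ge0.
have wB n : \sum_(0 <= i < n) d (w i) <= B.
  rewrite (le_trans _ sB)// -wsum -/d.
  rewrite -(@sum_nat_stable _ _ (maxn n (size s)) (size s)); last first.
    by move=> i; rewrite (minn_idPr (leq_maxr _ _)) => si; rewrite w0//;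
      exact: mdistxx.
  rewrite [leRHS](@big_cat_nat _ _ _ n) ?leq_maxl//=.
  by apply: ler_wpDr => //; apply: sumr_ge0 => i _; exact: d0.
have wdec i j : (i <= j)%N -> d (w j) <= d (w i).
  move=> ij; have [sj|js] := leqP (size s) j;
    first by rewrite (w0 j)// /d/= mdistxx mdist_ge0.
  apply: (@sorted_leq_nth _ leT); rewrite ?inE ?size_sort//.
  - by move=> p q t pq qt; exact: le_trans qt pq.
  - by move=> p; exact: lexx.
  - by apply: sort_sorted => p q; exact: le_total.
  - exact: leq_ltn_trans js.
have wn n : d (w n) * n.+1%:R <= B.
  rewrite (le_trans _ (wB n.+1))// mulr_natr -[n.+1 in leLHS]subn0
    -sumr_const_nat.
  by rewrite big_nat_cond [leRHS]big_nat_cond ler_sum// => i;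
    rewrite ltnS andbT => /wdec.
exists w; split => // h r' n rr' hr Brn; rewrite sg => [|a b ab]; last first.
  by apply: hr; exact: lt_le_trans rr'.
rewrite -(wsum (fun p => h p.1 - h p.2)).
apply: sum_nat_stable => i; rewrite geq_min => /orP[si|ni];
  first by rewrite w0// subrr.
apply/eqP; rewrite subr_eq0; apply/eqP/hr; rewrite ltNge; apply/negP => rd.
have /le_trans/(_ (wn i)) : r' * n.+1%:R <= d (w i) * i.+1%:R.
  rewrite (@le_trans _ _ (d (w i) * n.+1%:R)) ?ler_wpM2r ?ler_wpM2l ?ler_nat//.
by rewrite leNgt Brn.
Qed.

Hypothesis M_compact : compact [set: M].

(** The sequences at scales [1 / (k + 1)] have a cluster point by Tychonoff, and a locally constant
    [h] does not distinguish its entries from close approximants. *)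
Lemma limit_gap_sequence x y B : flat_dist x y < B ->
  exists2 w : nat -> M * M,
    forall n, \sum_(0 <= i < n) mdist (w i).1 (w i).2 <= B &
    forall h, (forall z, \forall z' \near z, h z' = h z) ->
      \forall n \near \oo, h x - h y = \sum_(0 <= i < n) (h (w i).1 - h (w
        i).2).
Proof.
move=> xyB.
have /choice[W WP] : forall k : nat, exists w : nat -> M * M, [/\
    forall n, \sum_(0 <= i < n) mdist (w i).1 (w i).2 <= B,
    forall n, mdist (w n).1 (w n).2 * n.+1%:R <= B &
    forall h r' n, k.+1%:R^-1 <= r' ->
      (forall a b, mdist a b < r' -> h a = h b) ->
      B < r' * n.+1%:R ->
      h x - h y = \sum_(0 <= i < n) (h (w i).1 - h (w i).2)].
  move=> k; apply: gap_sequence_exists; rewrite (le_lt_trans _ xyB)//.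
  by apply: flat_dist_at_le_flat_dist; rewrite invr_gt0.
have cMM : compact [set: M * M] by rewrite -setXTT; exact: compact_setX.
have [w [_ clw]] := @tychonoff nat (fun=> (M * M)%type) (fun=> setT) (fun=> cMM)
  (W @ \oo) _ (filterS (fun _ _ _ => I) filterT).
(* Clustering in the product controls finitely many coordinates at once, for arbitrarily large
   [k']. *)
have wP n r k : 0 < r -> exists2 k', (k <= k')%N & forall i, (i < n)%N ->
    mdist (w i).1 (W k' i).1 < r /\ mdist (w i).2 (W k' i).2 < r.
  move=> r0.
  pose A i : set {ptws nat -> (M * M)%type} :=
    [set v : nat -> M * M | mdist (w i).1 (v i).1 < r /\
      mdist (w i).2 (v i).2 < r].
  have nw : nbhs (w : {ptws nat ->
    (M * M)%type}) [set v | forall i : 'I_n, A i v].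
    apply: (@filter_forall _ 'I_n (fun i => A i) _ (nbhs_filter _)) => i.
    have pc := @proj_continuous nat (fun=> (M * M)%type) i w.
    apply: (pc [set p : M * M | mdist (w i).1 p.1 < r /\
      mdist (w i).2 p.2 < r]).
    exists (ball (w i).1 r, ball (w i).2 r); first by split; exact: nbhsx_ballx.
    by move=> p [/=]; rewrite !ballEmdist.
  have [|_ [[k' kk' <-] vw]] := clw [set W k' | k' in [set k' | (k <= k')%N]] _
    _ nw.
    by exists k => // k' kk'; exists k'.
  by exists k' => // i ni; exact: (vw (Ordinal ni)).
exists w => [n|h lch].
  apply/ler_addgt0Pr => e e0.
  have [q q0 nq] : exists2 q : R, 0 < q & n%:R * (2 * q) <= e.
    exists (e / n.+1%:R / 2); first by rewrite !divr_gt0.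
    rewrite [2 * _]mulrC divfK// mulrCA ler_piMr ?(ltW e0)//.
    by rewrite ler_pdivrMr// mul1r ler_nat.
  have [k _ kP] := wP n _ 0%N q0.
  have [/(_ n) WB _ _] := WP k.
  rewrite (le_trans _ (lerD WB nq))//.
  rewrite mulr_natl -[n in _ *+ n]subn0 -sumr_const_nat -big_split/=.
  rewrite big_nat_cond [leRHS]big_nat_cond; apply: ler_sum => i.
  rewrite andbT => /kP[w1 w2].
  have := metric_triangle (w i).1 (W k i).1 (w i).2.
  have := metric_triangle (W k i).1 (W k i).2 (w i).2.
  by have := metric_sym (W k i).2 (w i).2; lra.
have [r r0 hr] := locally_constant_scale M_compact lch.
near=> n.
(* The threshold for [n] involves only [B] and [r], so it serves every approximant [W k']. *)
have Brn : B < r * n.+1%:R.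
  rewrite -ltr_pdivrMl// (@lt_le_trans _ _ n%:R) ?ler_nat//.
  by near: n; exact: nbhs_infty_gtr.
have [k rk] : exists k : nat, k.+1%:R^-1 <= r.
  have [k _ kr] := nbhs_infty_gtr r^-1; exists k.
  rewrite -[leRHS]invrK lef_pV2 ?posrE ?invr_gt0//.
  by rewrite (le_trans (ltW (kr k (leqnn k))))// ler_nat.
have [k' kk' kP] := wP n r k r0.
have [_ _ /(_ h r n) ->//] := WP k'; last first.
  by rewrite (le_trans _ rk)// lef_pV2 ?posrE// ler_nat ltnS.
rewrite big_nat_cond [RHS]big_nat_cond; apply: eq_bigr => i;
  rewrite andbT => /kP[w1 w2].
by rewrite -(hr _ _ w1) -(hr _ _ w2).
Unshelve. all: by end_near. Qed.

End gap_lists.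

(** * Annihilators of the locally constant functions *)

Section annihilator.
Context {R : realType} {M : metricType R} (o : M).

(** A difference of two evaluations has norm at most the distance of the points, so the series
    converges absolutely, with partial sums in the span. *)
Lemma molecule_series (w : nat -> M * M) (B : R) :
  (forall n, \sum_(0 <= i < n) mdist (w i).1 (w i).2 <= B) ->
  exists m : free_space o, forall f : lip0 o,
    \sum_(0 <= i < n) (f (w i).1 - f (w i).2) @[n --> \oo] --> (m f : R).
Proof.
move=> wB.
pose d i := mdist (w i).1 (w i).2.
pose u (f : lip0 o) i : R := f (w i).1 - f (w i).2.
have d0 i : 0 <= d i by exact: mdist_ge0.
have sd : {homo series d : n m / (n <= m)%N >-> n <= m}.
  by apply/nondecreasing_seqP => n; rewrite /series/= big_nat_recr//= lerDl.
have cd : cvgn (series d).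
  by apply: nondecreasing_is_cvgn => //; exists B => _ [n _ <-]; exact: wB.
have ud f i : `|u f i| <= `|f| * d i by exact: lip0_le.
have cu f : cvgn (series (u f)).
  apply: normed_cvg; apply: (@series_le_cvg _ _ (fun i => `|f| * d i)).
  - by move=> i; exact: normr_ge0.
  - by move=> i; exact: mulr_ge0.
  - exact: ud.
  have -> : series (fun i => `|f| * d i) = (fun n => `|f| * series d n).
    by apply/funext => n; rewrite /series/= mulr_sumr.
  exact: is_cvgMl_tmp.
pose phi f : R^o := limn (series (u f)).
have lphi : linear phi.
  move=> a f g; apply: cvg_lim => //.
  have -> : series (u (a *: f + g)) = (fun n =>
    a * series (u f) n + series (u g) n).
    apply/funext => n; rewrite /series/= mulr_sumr -big_split/=.
    by apply: eq_bigr => i _; rewrite /u mulrBr addrACA -opprD.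
  by apply: cvgD; [apply: cvgMl_tmp; exact: cu|exact: cu].
have tail f k n : (k <= n)%N ->
    `|series (u f) n - series (u f) k| <= `|f| * (series d n - series d k).
  move=> kn; rewrite !sub_series_geq//.
  by rewrite mulr_sumr (le_trans (ler_norm_sum _ _ _))// ler_sum.
have [m mE] : exists m : free_space o, forall f, m f = phi f.
  apply: free_of_functional => // e e0.
  have [k _ kP] : \forall k \near \oo, `|limn (series d) - series d k| < e.
    by have /cvgrPdist_lt/(_ _ e0) := cd.
  exists ([seq (1, (w i).1) | i <- iota 0 k] ++ [seq (-1, (w i).2) | i <- iota
    0 k]).
  move=> f; rewrite big_cat !big_map/= -big_split/=.
  have -> : \sum_(i <- iota 0 k) (1 * f (w i).1 + -1 * f (w i).2) = series (u
    f) k.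
    by rewrite /series/= /index_iota subn0; apply: eq_bigr => i _;
      rewrite mul1r mulN1r.
  have cs : (fun n => `|series (u f) n - series (u f) k|) @ \oo -->
      `|phi f - series (u f) k|.
    by apply: cvg_norm; apply: cvgB; [exact: cu|exact: cvg_cst].
  rewrite -(cvg_lim _ cs)//; apply: limr_le; first by apply/cvg_ex; eexists;
    exact: cs.
  near=> n; have kn : (k <= n)%N by near: n; exact: nbhs_infty_ge.
  rewrite (le_trans (tail f k n kn))// mulrC ler_wpM2r//.
  have dn : series d n <= limn (series d) by exact: nondecreasing_cvgn_le.
  have := kP k (leqnn k); rewrite ltr_norml => /andP[_]; lra.
by exists m => f; rewrite mE; exact: cu.
Unshelve. all: by end_near. Qed.

Hypothesis M_compact : compact [set: M].

Lemma separates_free_flat_dist :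
  separates_free (@locally_constant_lip0 R M o) ->
  forall x y : M, mdist x y <= flat_dist x y.
Proof.
move=> ann x y; rewrite leNgt; apply/negP => xy.
pose B := (flat_dist x y + mdist x y) / 2.
have [] := midf_lt xy; rewrite -/B => xyB Bxy.
have [w wB wE] := limit_gap_sequence M_compact xyB.
have [m mP] := molecule_series wB.
(* On a locally constant [f] the partial sums for [m] are eventually [f x - f y], so [m'] vanishes
   there. *)
pose m' : free_space o := m - (free_delta o x - free_delta o y).
have m'E f : m' f = m f - (f x - f y) by [].
have m'0 : m' = 0.
  apply: ann => f lcf; rewrite m'E; apply/eqP; rewrite subr_eq0; apply/eqP.
  apply: (@cvg_unique _ (@Rhausdorff R) _ _ _ _ (mP f)).
  by apply: cvg_near_cst; apply: filterS (wE f lcf) => n ->.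
(* The distance to [y] detects [m']: it increases by [mdist x y] from [y] to [x], while [m] gives it
   at most [B]. *)
have [|g gL gE] := @lip0_of_lipschitz _ _ o (fun z => mdist z y) 1 ler01.
  by move=> a b; rewrite mul1r lerBlDr metric_triangle.
have gxy : g x - g y = mdist x y by rewrite !gE opprB addrA subrK mdistxx subr0.
have /eqP : m' g = 0 by rewrite m'0.
rewrite m'E gxy subr_eq0 => /eqP mg.
suff : m g <= B by rewrite mg leNgt Bxy.
rewrite -(cvg_lim _ (mP g))//; apply: limr_le; first by apply/cvg_ex; eexists;
  exact: mP.
apply: nearW => n; rewrite (le_trans _ (wB n))//; apply: ler_sum => i _.
by rewrite (le_trans (lip0_sub_le _ _ _))// ler_piMl ?mdist_ge0.
Qed.

Lemma flat_lipschitz_annihilated (m : free_space o) (g : lip0 o) (L : R) : 0 <=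
  L ->
  (forall f, locally_constant_lip0 f -> m f = 0) ->
  (forall x y, g x - g y <= L * flat_dist x y) -> m g = 0.
Proof.
move=> L0 mS gL; apply: (@free_eq0_approx _ _ _ _ _ L) => e e0.
by have [h [lch hL hg]] := flat_lipschitz_approx M_compact L0 e0 gL; exists h;
  split; rewrite ?mS.
Qed.

Lemma linear_locally_constant : linear_set (@locally_constant_lip0 R M o).
Proof.
split=> [x|a f g lcf lcg x]; first exact: nearW.
near=> y; have fy : f y = f x by near: y; exact: lcf.
have gy : g y = g x by near: y; exact: lcg.
by rewrite -[LHS]/(a * f y + g y) fy gy.
Unshelve. all: by end_near. Qed.

Lemma locally_constant_null_image (f : lip0 o) :
  locally_constant_lip0 f -> null_image_lip0 f.
Proof.
move=> lcf; have /compact_near_coveringP cM := M_compact.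
(* Finite lists ordered by inclusion parametrise the covering argument; it yields a list of all
   values, so the image is finite. *)
pose F : set_system (seq R) :=
  filter_from setT (fun s0 => [set s : seq R | {subset (s0 : seq R) <= s}]).
have FF : ProperFilter F.
  apply: filter_from_proper; last by move=> s _; exists s.
  apply: filter_from_filter; first by exists [::].
  move=> s1 s2 _ _; exists (s1 ++ s2) => // s sP.
  by split => c cs; apply: sP; rewrite mem_cat cs ?orbT.
have sF : \forall s \near F, [set: M] `<=` [set x | (f x : R) \in s].
  apply: cM => x _.
  exists ([set y | f y = f x], [set s : seq R | (f x : R) \in s]) => /=.
    by split; [exact: lcf|exists [:: f x : R] => // s; apply; rewrite mem_seq1].
  by move=> [y s] /= [->].
have [s sP] := @filter_ex _ _ FF _ sF; apply: countable_lebesgue_measure0.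
apply: (@sub_countable _ _ _ [set` s]); last exact: finite_set_countable.
by apply: subset_card_le => _ [x _ <-]; exact: sP.
Qed.

End annihilator.

(** * From null images to a trivial annihilator, and its consequences *)

Section separates_free.
Context {R : realType} {M : metricType R} (o : M).
Hypothesis M_compact : compact [set: M].

Lemma separates_free_of_null_image_dense :
  weak_star_dense (@null_image_lip0 R M o) ->
    separates_free (@locally_constant_lip0 R M o).
Proof.
move=> /weak_star_dense_separates_free nullS m mS; apply: nullS => f f0.
apply: (flat_lipschitz_annihilated M_compact (normr_ge0 f) mS) => x y.
exact: null_image_flat_lipschitz.
Qed.

(** Uniform separation gives [mdist <= C * flat_dist], so every Lipschitz function is Lipschitz for
    [flat_dist]. *)
Lemma separates_free_of_null_image_separates :
  separates_points_uniformly (@null_image_lip0 R M o) ->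
  separates_free (@locally_constant_lip0 R M o).
Proof.
move=> [C C1 Csep] m mS; have C0 : 0 <= C by exact: le_trans C1.
have dC (x y : M) : mdist x y <= C * flat_dist x y.
  have [->|xy] := eqVneq x y; first by rewrite mdistxx mulr_ge0// flat_dist_ge0.
  have [f [f0 fC <-]] := Csep x y xy.
  rewrite (@le_trans _ _ (`|f| * flat_dist x y))//; last first.
    by rewrite ler_wpM2r// flat_dist_ge0.
  rewrite ler_norml lerNl opprB null_image_flat_lipschitz// andbT flat_dist_sym.
  exact: null_image_flat_lipschitz.
apply: free_eq0 => g.
apply: (@flat_lipschitz_annihilated _ _ _ M_compact m g (`|g| * C))
  => // [|x y].
  by rewrite mulr_ge0.
by rewrite (le_trans (lip0_sub_le _ _ _))// -mulrA ler_wpM2l.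
Qed.

(** Since [flat_dist] equals [mdist], the extremal function at a small scale recovers more than half
    of [mdist x y]; a factor [c <= 2] restores equality. *)
Lemma separates_free_separates_points :
  separates_free (@locally_constant_lip0 R M o) ->
  separates_points_uniformly (@locally_constant_lip0 R M o).
Proof.
move=> /(separates_free_flat_dist M_compact) dflat; exists 2;
  first by rewrite ler1n.
move=> x y; rewrite -mdist_gt0 => xy.
have [|r r0 rxy] := @flat_dist_gt _ _ x y (mdist x y / 2).
  by rewrite (lt_le_trans _ (dflat x y))// ltr_pdivrMr// ltr_pMr// ltr1n.
have rxy0 : 0 < flat_dist_at r x y by rewrite (lt_trans _ rxy)// divr_gt0.
pose c := mdist x y / flat_dist_at r x y.
have c0 : 0 <= c by rewrite divr_ge0// ltW.
have c2 : c <= 2 by rewrite ler_pdivrMr// mulrC -ler_pdivrMr// ltW.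
have [k1 kr] := flat_at_dist r x.
have [|f fC fE] := @lip0_of_lipschitz _ _ o (fun z =>
  c * flat_dist_at r x z) 2 (ler0n _ 2).
  move=> a b; rewrite -mulrBr (le_trans (ler_wpM2l c0 (k1 a b)))//.
  by rewrite ler_wpM2r ?mdist_ge0.
exists f; split => // [z|].
  apply/nbhs_ballP; exists r => // z'; rewrite ballEmdist /= => zz'.
  by rewrite !fE (kr z z').
rewrite !fE opprB addrA subrK flat_dist_at_eq0 ?mdistxx//.
by rewrite mulr0 add0r normrN divfK ?gt_eqF// ger0_norm ?mdist_ge0.
Qed.

Lemma separates_free_totally_disconnected :
  separates_free (@locally_constant_lip0 R M o) ->
    totally_disconnected [set: M].
Proof.
move=> /separates_free_separates_points[C _ Csep].
apply: zero_dimension_totally_disconnected => x y xy.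
have [f [lcf _ fxy]] := Csep x y xy.
exists [set z | f z = f x]; split => //=; last first.
  by move=> fyx; move: xy; rewrite -mdist_gt0 -fxy fyx subrr normr0 ltxx.
split.
  by rewrite openE => z fz; apply: filterS (lcf z) => z' /= ->.
rewrite -[X in closed X]setCK; apply: open_closedC; rewrite openE => z fz.
by apply: filterS (lcf z) => z' /= ->.
Qed.

Lemma compact_bounded_mdist : exists2 D : R, 0 <= D & forall x, mdist o x <= D.
Proof.
have /compact_near_coveringP cM := M_compact.
have : \forall D \near +oo, [set: M] `<=` [set x | mdist o x <= D].
  apply: cM => x _.
  exists (ball x 1, [set D | mdist o x + 1 <= D]).
    by split; [exact: (nbhsx_ballx _ _ ltr01)|exact: (nbhs_pinfty_ge (num_real
      _))].
  move=> [y D] /= []; rewrite ballEmdist /= => xy.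
  by have := metric_triangle o x y; lra.
move=> /(filterI (nbhs_pinfty_ge (num_real (0:R))))/filter_ex[D [D0 DP]].
by exists D => // x; exact: DP.
Qed.

(** On the image of [f], [g] composed with the inverse of [f] is Lipschitz; McShane's infimal
    convolution extends it to [N]. *)
Lemma locally_constant_factor (N : metricType R) (o' : N)
    (f : M -> N) (g : lip0 o) :
  lip0_map o o' f -> injective f -> locally_constant_lip0 g ->
  exists G : lip0 o', forall x, G (f x) = g x.
Proof.
move=> [[K fK] fo] finj lcg.
have [r r0 gr] := locally_constant_scale M_compact lcg.
have K0 : 0 < Num.max K 0 + 1 by rewrite ltr_wpDl// le_max lexx orbT.
have {}fK a b : mdist (f a) (f b) <= (Num.max K 0 + 1) * mdist a b.
  rewrite (le_trans (fK a b))// ler_wpM2r ?mdist_ge0//.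
  by rewrite ler_wpDr// le_max lexx.
set C := Num.max K 0 + 1 in K0 fK.
(* The inverse of [f] is uniformly continuous by compactness. *)
have [q q0 fq] : exists2 q : R, 0 < q &
    forall a b, mdist (f a) (f b) < q -> mdist a b < r.
  have /compact_near_coveringP cMM := compact_setX M_compact M_compact.
  have : \forall q \near (0:R)^'+, [set: M] `*` [set: M] `<=`
      [set p | mdist (f p.1) (f p.2) < q -> mdist p.1 p.2 < r].
    apply: cMM => -[a b] _.
    have [<-|ab] := eqVneq a b.
      have r20 : 0 < r / 2 by rewrite divr_gt0.
      exists (ball a (r / 2) `*` ball a (r / 2), setT).
        split => /=; last exact: filterT.
        by exists (ball a (r / 2), ball a (r / 2)) => //; split;
          exact: nbhsx_ballx.
      move=> [[a' b'] q] [/= [aa' ab'] _] _; move: aa' ab';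
        rewrite !ballEmdist /=.
      by have := metric_triangle a' a b'; rewrite (metric_sym a' a); lra.
    have fab : 0 < mdist (f a) (f b).
      by rewrite mdist_gt0; apply: contra_neq ab; exact: finj.
    (* Within this radius each image moves by at most a quarter of the distance, so at least half of
       it remains. *)
    pose e := mdist (f a) (f b) / (4 * C).
    have e0 : 0 < e by rewrite divr_gt0// mulr_gt0.
    have eE : C * e = mdist (f a) (f b) / 4.
      by rewrite /e; field; rewrite gt_eqF.
    exists (ball a e `*` ball b e, [set q | q <= mdist (f a) (f b) / 2]).
      split => /=; last by apply: nbhs_right_le; rewrite divr_gt0.
      by exists (ball a e, ball b e) => //; split; exact: nbhsx_ballx.
    move=> [[a' b'] q] [/= [aa' bb'] qab] fab'; exfalso.
    move: aa' bb'; rewrite !ballEmdist /= => /ltW aa' /ltW bb'.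
    have := fK a a'; have := fK b b'.
    have := ler_wpM2l (ltW K0) aa'; have := ler_wpM2l (ltW K0) bb'; rewrite eE.
    have := metric_triangle (f a) (f a') (f b);
      have := metric_triangle (f a') (f b') (f b).
    by rewrite (metric_sym (f b') (f b)); lra.
  move=> /(filterI (nbhs_right_gt (0:R)))/filter_ex[q [q0 qP]].
  by exists q => // a b; exact: (qP (a, b)).
have [D D0 oD] := compact_bounded_mdist.
have gD a : `|g a| <= `|g| * D.
  rewrite -[g a]subr0 -(lip0_base g) (le_trans (lip0_le _ _ _))// metric_sym.
  by rewrite ler_wpM2l.
(* Images closer than [q] give equal values of [g]; beyond [q], the slope [L] pays for the whole
   oscillation of [g]. *)
pose L := 2 * (`|g| * D) / q.
have L0 : 0 <= L by rewrite divr_ge0 ?(ltW q0)// !mulr_ge0.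
have gL a b : g b - g a <= L * mdist (f a) (f b).
  have [/fq/gr->|qab] := ltP (mdist (f a) (f b)) q.
    by rewrite subrr mulr_ge0 ?mdist_ge0.
  rewrite (@le_trans _ _ (L * q))//; last by rewrite ler_wpM2l.
  rewrite /L divfK ?gt_eqF//.
  by have := gD a; have := gD b; rewrite !ler_norml => /andP[? ?] /andP[? ?];
    lra.
pose F y a := g a + L * mdist (f a) y.
have FB y a : - (`|g| * D) <= F y a.
  have := gD a; rewrite ler_norml => /andP[ga _].
  by rewrite /F ler_wpDr// mulr_ge0// mdist_ge0.
have GE b : inf (range (F (f b))) = g b.
  apply/eqP; rewrite eq_le; apply/andP; split.
    apply: ge_inf; first by exists (- (`|g| * D)) => _ [a _ <-].
    by exists b => //; rewrite /F mdistxx mulr0 addr0.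
  apply: lb_le_inf; first by exists (F (f b) o), o.
  by move=> _ [a _ <-]; rewrite /F -lerBlDl gL.
have [|G _ GP] := @lip0_of_lipschitz _ _ o' (fun y => inf (range (F y))) L L0.
  move=> y y'; rewrite lerBlDl; apply: (inf_range_le o (FB y)) => a; exists a.
  rewrite /F -addrA lerD2l -mulrDr ler_wpM2l// (metric_sym y y').
  exact: metric_triangle.
by exists G => x; rewrite GP GE -fo GE lip0_base subr0.
Qed.

(** As [g] factors through [f] by some [G], the value of an element at [g] is that of its image at
    [G]. *)
Lemma separates_free_lip_lin_injective :
  separates_free (@locally_constant_lip0 R M o) -> lip_lin_injective o.
Proof.
move=> ann N o' f fL _ finj m1 m2 m12; apply/eqP; rewrite -subr_eq0; apply/eqP.
apply: ann => g /(locally_constant_factor fL finj)[G Gf].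
have gE : g = lip0_comp fL G by apply/val_inj/funext => x; rewrite /= Gf.
have : free_map fL m1 G = free_map fL m2 G by rewrite m12.
rewrite gE => /eqP; rewrite -subr_eq0 => /eqP; exact.
Qed.

End separates_free.

(** * Zero flat distance and connectedness *)

Section totally_disconnected.
Context {R : realType} {M : metricType R}.
Hypothesis M_compact : compact [set: M].

(* A separation [E] of this set would extend, on points at flat distance [0]
   from [x] at some small scale, to a function that jumps and is flat at that
   scale. *)
Lemma connected_flat_dist0 (x : M) : connected [set z | flat_dist x z = 0].
Proof.
set Z := (X in connected X).
apply: contrapT => /connectedPn[E [Ene ZE [sep1 sep2]]].
have /compact_near_coveringP cM := M_compact.
have Zx : Z x by exact: flat_distxx.
have [b Eb] : exists b, E b x.
  by move: Zx; rewrite ZE => -[]; [exists false|exists true].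
have [y Ey] := Ene (~~ b).
have EZ c z : E c z -> Z z by rewrite ZE; case: c; [right|left].
have ZEb z : Z z -> E b z \/ E (~~ b) z.
  by rewrite ZE; case: (b) => /= -[]; tauto.
have sep c z : closure (E c) z -> E (~~ c) z -> False.
  case: c => /= cE Ez.
    by have : set0 z by rewrite -sep2; split.
  by have : set0 z by rewrite -sep1; split.
(* [Z] is closed, so the pieces have disjoint closures and each point has a neighbourhood away from
   one of them; compactness makes the gap uniform. *)
have [s s0 sP] : exists2 s : R, 0 < s &
    forall u v, E b u -> E (~~ b) v -> s <= mdist u v.
  have : \forall s \near (0:R)^'+, [set: M] `<=`
      [set u | exists c, forall e, E c e -> s <= mdist u e].
    apply: cM => u0 _.
    have [c] : exists c, ~ closure (E c) u0.
      apply: contrapT => /forallNP cl.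
      have {}cl c : closure (E c) u0 by apply: contrapT; exact: cl.
      have : Z u0.
        apply/eqP; rewrite eq_le flat_dist_ge0 andbT.
        apply/ler_addgt0Pr => e e0; rewrite add0r.
        have [z [/EZ xz]] := cl b _ (nbhsx_ballx u0 e e0).
        rewrite ballEmdist /= metric_sym => /ltW; apply: le_trans.
        rewrite (le_trans (flat_dist_triangle z x u0))// xz add0r.
        exact: flat_dist_le_mdist.
      by move/ZEb => -[|]; [rewrite -[b]negbK|]; exact/sep.
    move=> /existsNP[A /not_implyP[/nbhs_ballP[r /= r0 rA] EA]].
    have rP e : E c e -> ~ ball u0 r e.
      by move=> Ee re; apply: EA; exists e; split => //; exact: rA.
    have r20 : 0 < r / 2 by rewrite divr_gt0.
    exists (ball u0 (r / 2), [set s | s <= r / 2]).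
      by split; [exact: nbhsx_ballx|exact: nbhs_right_le].
    move=> [u s] [/=]; rewrite ballEmdist /= => u0u sr; exists c => e Ece.
    rewrite leNgt; apply/negP => ue; apply: (rP e) => //.
    by rewrite ballEmdist /=; have := metric_triangle u0 u e; lra.
  move=> /(filterI (nbhs_right_gt (0:R)))/filter_ex[s [s0 sP]].
  exists s => // u v Eu Ev; have [c cP] := sP u I.
  have [cb|cb] : c = b \/ c = ~~ b by case: (c) (b) => -[]; tauto.
    by have := cP u; rewrite cb mdistxx => /(_ Eu); lra.
  by apply: cP; rewrite cb.
have s30 : 0 < s / 3 by rewrite divr_gt0.
(* By compactness, at a small scale the points at distance 0 from [x] lie close to [Z]. *)
have [r [r0 rs rP]] : exists r : R, [/\ 0 < r, r <= s / 3 &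
    forall u, flat_dist_at r x u = 0 -> exists2 z, Z z & mdist u z < s / 3].
  have : \forall r \near (0:R)^'+, [set: M] `<=`
      [set u | flat_dist_at r x u = 0 -> exists2 z, Z z & mdist u z < s / 3].
    apply: cM => u0 _; have [Zu0|Zu0] := pselect (Z u0).
      exists (ball u0 (s / 3), setT).
        by split; [exact: nbhsx_ballx|exact: filterT].
      move=> [u r] [/=]; rewrite ballEmdist /= => u0u _ _; exists u0 => //.
      by rewrite metric_sym.
    have /flat_dist_gt[r r0 ru0] : 0 < flat_dist x u0.
      by rewrite lt_neqAle flat_dist_ge0 andbT eq_sym; exact/eqP.
    exists (ball u0 (flat_dist_at r x u0), [set r' | r' <= r]).
      by split; [exact: nbhsx_ballx|exact: nbhs_right_le].
    move=> [u r'] [/=]; rewrite ballEmdist /= => u0u r'r r'u; exfalso.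
    have := le_flat_dist_at x u r'r; have := flat_dist_at_triangle r u x u0.
    have := flat_dist_at_le_mdist r u u0; rewrite (metric_sym u u0); lra.
  move=> H; have [r [[r0 rs] rP]] :=
    filter_ex (filterI (filterI (nbhs_right_gt (0:R)) (nbhs_right_le s30)) H).
  by exists r; split => // u; exact: rP.
pose U := [set u | flat_dist_at r x u = 0 /\
  exists2 e, E b e & mdist u e < s / 3].
(* Three hops, each shorter than [s / 3], cannot reach the other piece. *)
have UU a c : U a -> mdist a c < r -> U c.
  move=> [xa [e Ee ae]] ac.
  have xc : flat_dist_at r x c = 0.
    apply/eqP; rewrite eq_le flat_dist_at_ge0 andbT.
    by rewrite (le_trans (flat_dist_at_triangle r a x c))// xa add0r
      flat_dist_at_eq0.
  split => //; have [z /ZEb[Ez|Ez] cz] := rP c xc; first by exists z.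
  have := sP e z Ee Ez; have := metric_triangle e a z;
    have := metric_triangle a c z.
  by rewrite (metric_sym e a); lra.
(* Leaving [U] takes a move of length at least [r], so a jump of height [r] is 1-Lipschitz. *)
pose h u : R := if asbool (U u) then r else 0.
have hflat : flat_at r h.
  split=> a c; rewrite /h; last first.
    move=> ac; have [Ua|Ua] := asboolP (U a);
      have [Uc|Uc] := asboolP (U c) => //.
      by case: Uc; exact: UU ac.
    by case: Ua; apply: UU Uc _; rewrite metric_sym.
  case: asboolP => [Ua|_]; case: asboolP => [_|Uc]; rewrite ?subrr ?mdist_ge0//.
    by rewrite subr0 leNgt; apply/negP => /(UU _ _ Ua).
  by rewrite sub0r (le_trans _ (mdist_ge0 _ _))// oppr_le0 ltW.
have := le_trans (flat_dist_at_ge x y hflat) (flat_dist_at_le_flat_dist x y r0).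
rewrite (EZ _ _ Ey) /h; case: asboolP => [_|[]]; last first.
  by split; [apply/eqP; rewrite flat_dist_at_eq0 ?mdistxx|exists x;
    rewrite ?mdistxx].
case: asboolP => [[_ [e Ee ye]]|_]; last by rewrite subr0 leNgt r0.
by have := sP e y Ee Ey; rewrite metric_sym; lra.
Qed.

Lemma totally_disconnected_flat_dist0 : totally_disconnected [set: M] ->
  forall x y : M, flat_dist x y = 0 -> x = y.
Proof.
move=> dM x y xy; have := dM x I.
have xZ : [set z | flat_dist x z = 0] x by exact: flat_distxx.
have := @connected_component_max _ [set: M] _ x xZ (@subsetT _ _)
  (@connected_flat_dist0 x).
by move=> /[swap] -> /(_ y xy).
Qed.

End totally_disconnected.

(** * The space with the flat distance as metric *)

Section flat_space.
Context {R : realType} {M : metricType R} (o : M).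

(* A copy of [M] that carries the metric [flat_dist]; the argument is what makes
   it a metric rather than a pseudometric. *)
Definition flat_space
  (_ : forall x y : M, flat_dist x y = 0 -> x = y) : Type := M.

Hypothesis flat0 : forall x y : M, flat_dist x y = 0 -> x = y.

HB.instance Definition _ := Choice.copy (flat_space flat0) M.

HB.instance Definition _ := @isMetric.Build R (flat_space flat0)
  (@flat_dist R M : flat_space flat0 -> flat_space flat0 ->
    R) (@flat_distxx R M) flat0 (@flat_dist_sym R M)
  (@flat_dist_triangle R M).

Definition to_flat_space (x : M) : flat_space flat0 := x.

Lemma to_flat_space_lip0 : lip0_map o (to_flat_space o) to_flat_space.
Proof. by split => //; exists 1 => x y; rewrite mul1r;
  exact: flat_dist_le_mdist. Qed.

Hypothesis M_compact : compact [set: M].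

(** The identity from [M] is continuous, so compactness passes over, and a Cauchy filter converges
    to its cluster point. *)
Lemma flat_space_complete : complete_space (flat_space flat0).
Proof.
move=> F FF Fc.
have cto : continuous to_flat_space.
  move=> x A /nbhs_ballP[e /= e0 eA]; apply/nbhs_ballP; exists e => // y.
  rewrite ballEmdist /= => xy; apply: eA; rewrite ballEmdist.
  exact: le_lt_trans (flat_dist_le_mdist x y) xy.
have : compact (to_flat_space @` [set: M]).
  by apply: continuous_compact => //; exact: continuous_subspaceT.
move=> /(_ F FF)[|p [_ pF]].
  by apply: filterS filterT => x _; exists x.
exists p => A /nbhs_ballP[e /= e0 eA].
have e30 : 0 < e / 3 by rewrite divr_gt0.
have /cauchyP/(_ _ e30)[x Fx] := Fc.
have [z [xz pz]] := pF _ _ Fx (nbhsx_ballx p (e / 3) e30).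
apply: filterS Fx => y xy; apply: eA; move: xz pz xy;
  rewrite !ballEmdist /= => xz pz xy.
have := metric_triangle p z y; have := metric_triangle z x y.
by rewrite (metric_sym z x); lra.
Qed.
End flat_space.

Lemma lip_lin_injective_separates_free {R : realType} {M : metricType R} (o :
  M) :
  compact [set: M] -> totally_disconnected [set: M] -> lip_lin_injective o ->
  separates_free (@locally_constant_lip0 R M o).
Proof.
move=> cM dM inj m mS.
have flat0 := totally_disconnected_flat_dist0 cM dM.
pose tL := to_flat_space_lip0 o flat0.
(* It remains to see that the image of [m] is 0: it tests [m] on functions that are Lipschitz for
   [flat_dist]. *)
apply: (inj _ _ _ tL (flat_space_complete cM)); first by move=> x y.
apply: val_inj; apply: val_inj; apply/funext => g /=.
apply: (flat_lipschitz_annihilated cM (normr_ge0 g) mS) => x y.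
exact: (lip0_sub_le g (to_flat_space flat0 x) (to_flat_space flat0 y)).
Qed.

Theorem theorem4p7 (R : realType) (M : metricType R) (o : M)
    (M_compact : compact [set: M]) :
  [<-> weak_star_dense (@locally_constant_lip0 R M o);
       weak_star_dense (@null_image_lip0 R M o);
       separates_points_uniformly (@locally_constant_lip0 R M o);
       separates_points_uniformly (@null_image_lip0 R M o);
       lip_lin_injective o /\ totally_disconnected [set: M]].
Proof.
have lcnull := @locally_constant_null_image R M o M_compact.
(* In the cycle, the first and third implications are inclusions of sets of functions; the others
   pass through [separates_free] for the locally constant functions. *)
tfae.
- by move=> dS O O0 /(dS O O0)[f [Of /lcnull f0]]; exists f.
- move=> /(separates_free_of_null_image_dense M_compact).
  exact: separates_free_separates_points.
- move=> [C C1 Csep]; exists C => // x y /Csep[f [/lcnull f0 fC fxy]].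
  by exists f.
- move=> /(separates_free_of_null_image_separates M_compact) ann.
  split; first exact: separates_free_lip_lin_injective.
  exact: (@separates_free_totally_disconnected _ _ o).
- move=> [inj dM]; apply: separates_free_weak_star_dense.
    exact: linear_locally_constant.
  exact: lip_lin_injective_separates_free.
Qed.
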